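(* Let $E$ be a Banach space. If there exist an infinite Tychonoff space $X$ and a homeomorphism $T: C_p(X) \to E_{w}$, then (a) $X$ is a countable union of compact sets $X_n$, $n \in \omega$, where at least one of the sets $X_n$ is non-scattered; and (b) $E$ contains a closed subspace isomorphic to the Banach space $\ell_{1}$.
   Context: For a Tychonoff space $X$, $C_p(X)$ denotes the space of all continuous real-valued functions on $X$ with the topology of pointwise convergence. For a Banach space $E$, $E_w$ denotes $E$ endowed with its weak topology. A topological space is scattered if every nonempty subspace has an isolated point. *)

(* Defs.v *)
From HB Require Import structures.
From mathcomp Require Import all_boot all_order all_algebra.
From mathcomp Require Import all_classical all_reals all_analysis.
Set Implicit Arguments. Unset Strict Implicit. Unset Printing Implicit Defensive.
Import Order.TTheory GRing.Theory Num.Theory.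
Import numFieldNormedType.Exports.
Local Open Scope classical_set_scope.
Local Open Scope ring_scope.

Definition tychonoff_space (R : realType) (X : topologicalType) : Prop :=
  hausdorff_space X /\
  forall (x : X) (B : set X), closed B -> ~ B x ->
    exists f : X -> R, [/\ continuous f, f x = 0 & forall y, B y -> f y = 1].

Definition scattered (X : topologicalType) (S : set X) : Prop :=
  forall A : set X, A `<=` S -> A !=set0 -> exists x, isolated A x.

Record cont_dual (R : realType) (E : normedModType R) := ContDual {
  cd_fun : E -> R^o;
  cd_linear : linear cd_fun;
  cd_cont : continuous cd_fun }.

(* The weak topology on E: the initial topology of the evaluation map
   E -> R^(dual of E) (product topology), i.e. the coarsest topology making every
   continuous linear functional continuous. *)
Definition weak_eval (R : realType) (E : normedModType R) :
  E -> {ptws cont_dual E -> R} := fun e phi => cd_fun phi e.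

Notation weak_topology E := (initial_topology (@weak_eval _ E)).

Definition Cp_set (R : realType) (X : topologicalType) : set {ptws X -> R} :=
  [set f | continuous (f : X -> R)].

Definition Cp_weak_homeomorphism (R : realType) (X : topologicalType)
    (E : normedModType R) (T : {ptws X -> R} -> weak_topology E) : Prop :=
  exists S : weak_topology E -> {ptws X -> R},
    [/\ (forall f, Cp_set f -> S (T f) = f),
        (forall e, Cp_set (S e)),
        (forall e, T (S e) = e),
        {within @Cp_set R X, continuous T} &
        continuous S].

Definition ell1 (R : realType) : set (nat -> R) :=
  [set u : nat -> R | cvgn (series (fun k => `|u k|))].

Definition ell1_norm (R : realType) (u : nat -> R) : R :=
  limn (series (fun k => `|u k|)).

Definition contains_closed_copy_of_ell1 (R : realType)
    (E : normedModType R) : Prop :=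
  exists (F : set E) (J : (nat -> R) -> E),
    [/\ closed F,
        F 0 /\ (forall (a : R) (x y : E), F x -> F y -> F (a *: x + y)),
        set_bij (@ell1 R) F J,
        (forall (a : R) (u v : nat -> R), @ell1 R u -> @ell1 R v ->
            J (fun k => a * u k + v k) = a *: J u + J v) &
        exists c C : R, [/\ 0 < c, 0 < C &
          forall u, @ell1 R u ->
            c * ell1_norm u <= `|J u| /\ `|J u| <= C * ell1_norm u]].

(* Main.v *)
From Stdlib Require List.
Require Import Defs.
From HB Require Import structures.
From mathcomp Require Import all_boot all_order all_algebra.
From mathcomp Require Import all_classical all_reals all_analysis.
From mathcomp Require Import ring lra.
Set Implicit Arguments. Unset Strict Implicit. Unset Printing Implicit Defensive.
Import Order.TTheory GRing.Theory Num.Theory.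
Import numFieldNormedType.Exports.
Local Open Scope classical_set_scope.
Local Open Scope ring_scope.

(* Let T : C_p(X) -> E_w be a homeomorphism with inverse S. By a Baire category
   argument T maps some sup-norm ball to a norm bounded set, and after
   recentring and rescaling we may assume T 0 = 0 and |T f| <= C for |f| <= 2.

   (a) Let X_n be the set of x for which n functionals of norm at most n control
   S e x near e = 0 (|phi_i e| < 1 for all i implies |S e x| <= 1). These sets
   cover X, and limits of functionals along ultrafilters show that they are
   compact, because the points controlled by a given tuple are finitely many.
   If all X_n were scattered, the first player would win the point-open game on
   X, so that C_p(X) would be strictly Frechet-Urysohn: one could choose f_n
   with |T f_n| = 3^n converging to 0 pointwise, although weakly null sequences
   are bounded.

   (b) A non-scattered X_N carries a Cantor scheme: points t_r of X_N, r in 2^w,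
   separated by continuous functions. To each r are attached the N functionals
   controlling t_r and the finite set Y_r of points on which T, tested against
   these functionals, depends near 0. Uncountability of 2^w provides functions
   g_n such that every pattern of the alternatives "g_n (t_r) = 2" and
   "g_n = 0 on Y_r" is realised by some r. For e_n = T g_n these become "some
   functional is at least 1 in absolute value on e_n" and "all of them are at
   most 1/2", and Rosenthal's dichotomy extracts a subsequence of the bounded
   sequence (e_n) that is equivalent to the unit basis of l_1. *)

(** * Bounded functionals, Hahn-Banach theorem, ultrafilter limits *)

Section bounded_functionals.
Context (R : realType) (E : normedModType R).
Implicit Types (phi psi : E -> R) (M : R).

(** Functionals are bare functions with an explicit bound [M], since uniform bounds pass to limits
    along ultrafilters; [cont_dual] only enters when the weak topology is translated. *)
Definition bounded_functional M phi : Prop :=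
  (forall a x y, phi (a *: x + y) = a * phi x + phi y) /\
  (forall e, `|phi e| <= M * `|e|).

Lemma bounded_functional0 M phi : bounded_functional M phi -> phi 0 = 0.
Proof.
move=> [H _]; have := H 1 0 0.
by rewrite scale1r mul1r addr0 => /eqP; rewrite -subr_eq subrr => /eqP <-.
Qed.

Lemma bounded_functionalD M phi x y : bounded_functional M phi ->
  phi (x + y) = phi x + phi y.
Proof. by move=> [H _]; have := H 1 x y; rewrite scale1r mul1r. Qed.

Lemma bounded_functionalZ M phi a x : bounded_functional M phi ->
  phi (a *: x) = a * phi x.
Proof.
move=> H; have := H.1 a x 0.
by rewrite addr0 (bounded_functional0 H) addr0.
Qed.

Lemma bounded_functionalN M phi x : bounded_functional M phi ->
  phi (- x) = - phi x.
Proof.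
by move=> H; rewrite -scaleN1r (bounded_functionalZ _ _ H) mulN1r.
Qed.

Lemma bounded_functionalB M phi x y : bounded_functional M phi ->
  phi (x - y) = phi x - phi y.
Proof.
by move=> H; rewrite (bounded_functionalD _ _ H) (bounded_functionalN _ H).
Qed.

Lemma bounded_functional_sum M phi (u : nat -> E) n : bounded_functional M phi ->
  phi (\sum_(k < n) u k) = \sum_(k < n) phi (u k).
Proof.
move=> H; elim: n => [|n IH]; first by rewrite !big_ord0 (bounded_functional0 H).
by rewrite !big_ord_recr /= (bounded_functionalD _ _ H) IH.
Qed.

Lemma bounded_functional_weaken M M' phi : M <= M' ->
  bounded_functional M phi -> bounded_functional M' phi.
Proof.
move=> MM' [H1 H2]; split=> // e; apply: le_trans (H2 e) _.
exact: ler_wpM2r.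
Qed.

Lemma cont_dual_bounded (phi : cont_dual E) :
  exists2 M, 0 <= M & bounded_functional M (cd_fun phi).
Proof.
case: phi => f flin fcont /=.
pose fL := GRing.isLinear.Build R E R^o *:%R f flin.
pose g : {linear E -> R^o} := HB.pack f fL.
have gc : {for 0, continuous g} by exact: fcont.
have /continuous_linear_bounded/linear_boundedP [M [Mr HM]] := gc.
have M1 : M < `|M| + 1 by rewrite (le_lt_trans (ler_norm _)) ?ltrDl.
have HM' := HM _ M1.
exists (`|M| + 1); first by rewrite addr_ge0.
split=> [a x y|e]; first exact: flin.
exact: HM'.
Qed.

Lemma bounded_cont_dual M phi : bounded_functional M phi ->
  exists psi : cont_dual E, cd_fun psi = phi.
Proof.
move=> [H1 H2].
have flin : linear (phi : E -> R^o) by move=> a x y; exact: H1.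
pose fL := GRing.isLinear.Build R E R^o *:%R (phi : E -> R^o) flin.
pose g : {linear E -> R^o} := HB.pack (phi : E -> R^o) fL.
have gc : continuous g.
  apply: bounded_linear_continuous; apply/linear_boundedP.
  exists M; split; first exact: num_real.
  move=> r Mr x; apply: le_trans (H2 x) _.
  by rewrite ler_wpM2r// ltW.
by exists (@ContDual R E phi flin gc).
Qed.

End bounded_functionals.

Section hahn_banach.
Context (R : realType) (E : normedModType R).

Lemma le_inf_add (A B : set R) c : A !=set0 -> B !=set0 ->
  (forall a b, A a -> B b -> c <= a + b) -> c <= inf A + inf B.
Proof.
move=> A0 B0 H; rewrite -lerBlDr; apply: lb_le_inf => // a Aa.
rewrite lerBlDl -lerBlDr; apply: lb_le_inf => // b Bb.
by rewrite lerBlDr addrC H.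
Qed.

(** Domination by the norm also gives the lower bound [- |x|], so pointwise infima of families of
    such functionals are finite. *)
Definition sublinear (q : E -> R) : Prop :=
  [/\ forall x y, q (x + y) <= q x + q y,
      forall (t : R) x, 0 < t -> q (t *: x) <= t * q x &
      forall x, q x <= `|x|].

Lemma sublinear_norm : sublinear (fun x => `|x|).
Proof.
split=> // [x y|t x t0]; first exact: ler_normD.
by rewrite normrZ gtr0_norm.
Qed.

Lemma sublinear0 q : sublinear q -> q 0 = 0.
Proof.
move=> [_ H2 H3]; apply/eqP; rewrite eq_le.
have := H3 0; rewrite normr0 => -> /=.
have := H2 2 0 (ltr0n _ 2); rewrite scaler0; lra.
Qed.

Lemma sublinearZ q t x : sublinear q -> 0 <= t -> q (t *: x) = t * q x.
Proof.
move=> sq; rewrite le_eqVlt => /orP[/eqP <-|t0].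
  by rewrite scale0r mul0r sublinear0.
case: sq => _ H2 _; apply/eqP; rewrite eq_le H2//=.
have := H2 t^-1 (t *: x); rewrite invr_gt0 => /(_ t0).
by rewrite scalerA mulVf ?gt_eqF// scale1r ler_pdivlMl.
Qed.

Lemma sublinear_ge q x : sublinear q -> - q (- x) <= q x.
Proof.
move=> sq; have [H1 _ _] := sq; have := H1 x (- x).
rewrite subrr sublinear0//; lra.
Qed.

Lemma sublinear_lb q x : sublinear q -> - `|x| <= q x.
Proof.
move=> sq; apply: le_trans (sublinear_ge x sq).
have [_ _ /(_ (- x))] := sq; rewrite normrN; lra.
Qed.

Let tilt_set (q : E -> R) w x : set R :=
  [set q (x + t *: w) - t * q w | t in [set t : R | 0 <= t]].

(** The classical modification of [q] in the direction [w]: still sublinear, below [q], and at most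
    [- q w] at [- w] (take [t = 1]). *)
Let tilt q w x := inf (tilt_set q w x).

Let tilt_set0 q w x : tilt_set q w x !=set0.
Proof. by exists (q (x + 0 *: w) - 0 * q w), 0 => /=. Qed.

Let tilt_lb q w x : sublinear q -> lbound (tilt_set q w x) (- q (- x)).
Proof.
move=> sq _ [t /= t0 <-]; have [H1 _ _] := sq.
have := H1 (x + t *: w) (- x); rewrite addrAC subrr add0r sublinearZ//; lra.
Qed.

Let tilt_le q w x t : sublinear q -> 0 <= t -> tilt q w x <= q (x + t *: w) - t * q w.
Proof.
move=> sq t0; apply: ge_inf; last by exists t.
by exists (- q (- x)); exact: tilt_lb.
Qed.

Let tilt_self q w x : sublinear q -> tilt q w x <= q x.
Proof.
by move=> sq; have := tilt_le w x sq (lexx 0); rewrite scale0r addr0 mul0r subr0.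
Qed.

Let tilt_sublinear q w : sublinear q -> sublinear (tilt q w).
Proof.
move=> sq; have [H1 H2 H3] := sq; split.
- move=> x y; apply: le_inf_add; try exact: tilt_set0.
  move=> _ _ [s /= s0 <-] [t /= t0 <-].
  apply: le_trans (tilt_le w (x + y) sq (addr_ge0 s0 t0)) _.
  have := H1 (x + s *: w) (y + t *: w).
  rewrite addrACA -scalerDl; lra.
- move=> t x t0; rewrite -ler_pdivrMl//; apply: lb_le_inf; first exact: tilt_set0.
  move=> _ [s /= s0 <-]; rewrite ler_pdivrMl//.
  apply: le_trans (tilt_le w (t *: x) sq (mulr_ge0 (ltW t0) s0)) _.
  by rewrite -scalerA -scalerDr sublinearZ ?(ltW t0)//; lra.
- by move=> x; apply: le_trans (tilt_self _ _ sq) _.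
Qed.

(** Zorn's lemma for the reversed pointwise order. A nonempty chain is bounded by its pointwise
    infimum, subadditive because any two members are comparable; the empty chain is bounded by
    [p]. *)
Lemma minimal_sublinear p : sublinear p -> exists q, [/\ sublinear q,
  forall x, q x <= p x & forall q', sublinear q' -> (forall x, q' x <= q x) -> q' = q].
Proof.
move=> sp; pose T := {q : E -> R | sublinear q /\ forall x, q x <= p x}.
pose mk q H : T := exist _ q H.
pose le (a b : T) := `[< forall x, sval b x <= sval a x >].
have [||||[q [sq qp]] qmin] := @Zorn T le.
- by move=> a; apply/asboolP.
- move=> a b c /asboolP ab /asboolP bc; apply/asboolP => x.
  exact: le_trans (ab x).
- move=> [a Ha] [b Hb] /asboolP /= ab /asboolP /= ba; apply: eq_exist => /=.
  by apply/funext => x; apply/eqP; rewrite eq_le ab ba.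
- move=> A Atot; have [[a0 Aa0]|A0] := pselect (A !=set0); last first.
    exists (mk p (conj sp (fun x => lexx _))) => a Aa.
    by exfalso; apply: A0; exists a.
  pose B x : set R := [set sval a x | a in A].
  have B0 x : B x !=set0 by exists (sval a0 x), a0.
  have Blb x : lbound (B x) (- `|x|).
    by move=> _ [a Aa <-]; apply: sublinear_lb; case: (svalP a).
  have Ble x a : A a -> inf (B x) <= sval a x.
    by move=> Aa; apply: ge_inf; [exists (- `|x|); exact: Blb|exists a].
  have sB : sublinear (fun x => inf (B x)).
    split.
    + move=> x y; apply: le_inf_add => //.
      move=> _ _ [a Aa <-] [b Ab <-].
      have [[sa1 _ _] _] := svalP a; have [[sb1 _ _] _] := svalP b.
      have [/asboolP ab|/asboolP ba] := Atot _ _ Aa Ab.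
      * apply: le_trans (Ble _ _ Ab) _; apply: le_trans (sb1 _ _) _.
        by rewrite lerD2r.
      * apply: le_trans (Ble _ _ Aa) _; apply: le_trans (sa1 _ _) _.
        by rewrite lerD2l.
    + move=> t x t0; rewrite -ler_pdivrMl//; apply: lb_le_inf => //.
      move=> _ [a Aa <-]; rewrite ler_pdivrMl//.
      apply: le_trans (Ble _ _ Aa) _.
      by have [[_ sa2 _] _] := svalP a; exact: sa2.
    + move=> x; apply: le_trans (Ble _ _ Aa0) _.
      by have [[_ _ sa3] _] := svalP a0.
  have Bp x : inf (B x) <= p x.
    by apply: le_trans (Ble _ _ Aa0) _; have [_] := svalP a0; exact.
  exists (mk (fun x => inf (B x)) (conj sB Bp)) => a Aa; apply/asboolP => x /=.
  exact: Ble.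
exists q; split=> // q' sq' q'q.
have q'p x : q' x <= p x by apply: le_trans (q'q x) (qp x).
by have := qmin (mk q' (conj sq' q'p)); rewrite /le => /(_ (introT (asboolP _) q'q)) [].
Qed.

(* A minimal sublinear functional coincides with each of its tilts, which
   forces it to be odd, hence linear. *)
Lemma hahn_banach_norming (v : E) :
  exists2 phi : E -> R, bounded_functional 1 phi & phi v = `|v|.
Proof.
(* Starting below the tilt of the norm at [v] forces [q (- v) <= - |v|], which becomes the norming
   equality once [q] is odd. *)
have [q [sq qle qmin]] := minimal_sublinear (tilt_sublinear v sublinear_norm).
have qN w : q (- w) = - q w.
  apply/eqP; rewrite eq_le; apply/andP; split; last first.
    by have := sublinear_ge (- w) sq; rewrite opprK.
  have := tilt_le w (- w) sq ler01.
  rewrite (qmin _ (tilt_sublinear w sq) (fun x => tilt_self w x sq)).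
  by rewrite scale1r addNr (sublinear0 sq) mul1r sub0r.
have [H1 H2 H3] := sq.
have qD x y : q (x + y) = q x + q y.
  apply/eqP; rewrite eq_le H1/=.
  have := H1 (x + y) (- y); rewrite addrK qN; lra.
have qZ a x : q (a *: x) = a * q x.
  have [a0|a0] := leP 0 a; first exact: sublinearZ.
  by rewrite -[a]opprK scaleNr qN sublinearZ ?mulNr// oppr_ge0 ltW.
exists q.
  split=> [a x y|e]; first by rewrite qD qZ.
  by rewrite mul1r ler_norml H3 (sublinear_lb e sq).
apply/eqP; rewrite eq_le H3/=.
have := qle (- v); have := tilt_le v (- v) sublinear_norm ler01.
rewrite scale1r addNr normr0 mul1r qN; lra.
Qed.

End hahn_banach.

Section ultrafilter_limits.
Context (R : realType) (E : normedModType R).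

Lemma ultra_bounded_cvg (T : Type) (F : set_system T) (h : T -> R) (M : R) :
  UltraFilter F -> F [set i | `|h i| <= M] ->
  exists l, forall eps : R, 0 < eps -> F [set i | `|h i - l| < eps].
Proof.
move=> FU FM.
have : (h @ F) `[- M, M]%classic.
  suff : F (h @^-1` `[- M, M]%classic) by [].
  by apply: filterS FM => i /=; rewrite in_itv /= ler_norml.
move=> /(@segment_compact R (- M) M (h @ F) _)[l [_ hl]].
exists l => eps eps0.
have [//|Fc] := in_ultra_setVsetC [set i | `|h i - l| < eps] FU.
have [y [/= hy ly]] : (~` [set y : R | `|y - l| < eps]) `&` ball l eps !=set0.
  by apply: hl => //; exact: nbhsx_ballx.
by exfalso; apply: hy; rewrite distrC.
Qed.

(** The Banach-Alaoglu theorem in ultrafilter form: the limit is taken pointwise, and linearity and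
    the bound survive. *)
Lemma ultra_functional_limit (T : Type) (F : set_system T) (psi : T -> E -> R) M :
  UltraFilter F -> F [set i | bounded_functional M (psi i)] ->
  exists2 phi, bounded_functional M phi &
    forall e (eps : R), 0 < eps -> F [set i | `|psi i e - phi e| < eps].
Proof.
move=> FU Fb.
have /choice[phi Hphi] : forall e, exists l, forall eps : R, 0 < eps ->
    F [set i | `|psi i e - l| < eps].
  move=> e; apply: (@ultra_bounded_cvg _ _ _ (M * `|e|)) => //.
  by apply: filterS Fb => i [_]; exact.
exists phi => //; split=> [a x y|e].
  apply/eqP; rewrite -subr_eq0; apply/negPn/negP => ne.
  set d := phi _ - _ in ne; have d0 : 0 < `|d| by rewrite normr_gt0.
  pose eps := `|d| / (3 + `|a|).
  have eps0 : 0 < eps by rewrite divr_gt0 ?ltr_wpDr.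
  have [i [[[[lin _] H1] H2] H3]] := filter_ex (filterI (filterI (filterI Fb
    (Hphi (a *: x + y) _ eps0)) (Hphi x _ eps0)) (Hphi y _ eps0)).
  have : `|d| < eps * (3 + `|a|); last first.
    by rewrite divfK ?ltxx// gt_eqF ?ltr_wpDr.
  have -> : d = - (psi i (a *: x + y) - phi (a *: x + y)) +
      a * (psi i x - phi x) + (psi i y - phi y) by rewrite lin /d; ring.
  have H2' : `|a * (psi i x - phi x)| <= `|a| * eps.
    by rewrite normrM ler_wpM2l// ltW.
  have H1' : `|- (psi i (a *: x + y) - phi (a *: x + y))| < eps by rewrite normrN.
  have T1 := ler_normD (- (psi i (a *: x + y) - phi (a *: x + y)) +
      a * (psi i x - phi x)) (psi i y - phi y).
  have T2 := ler_normD (- (psi i (a *: x + y) - phi (a *: x + y))) (a * (psi i x - phi x)).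
  have -> : eps * (3 + `|a|) = 3 * eps + `|a| * eps by ring.
  rewrite /= in H3; lra.
rewrite leNgt; apply/negP => lt.
have d0 : 0 < `|phi e| - M * `|e| by rewrite subr_gt0.
have [i [[_ b] /= H]] := filter_ex (filterI Fb (Hphi e _ d0)).
have := lerB_dist (phi e) (psi i e); have {}b := b e; rewrite distrC; lra.
Qed.

(** Limits along this free ultrafilter replace the extraction of convergent subsequences. *)
Lemma eventually_ultra : exists2 F : set_system nat, UltraFilter F &
  forall n, F [set k | (n <= k)%N].
Proof.
have [F [FU sF]] := ultraFilterLemma eventually_filter.
by exists F => // n; apply: sF; exists n.
Qed.

(* Each sign is chosen so that the k-th correction cannot be cancelled at
   [e k]; the tail of the series contributes at most half of it. *)
Lemma exponential_growth_not_weakly_null (e : nat -> E) :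
  (forall k, `|e k| = 3 ^+ k) ->
  exists M phi, [/\ 0 <= M, bounded_functional M phi & forall k, 1 / 2 <= `|phi (e k)|].
Proof.
move=> enorm.
have /choice[f Hf] : forall k, exists phi : E -> R,
    bounded_functional 1 phi /\ phi (e k) = `|e k|.
  by move=> k; have [phi ? ?] := hahn_banach_norming (e k); exists phi.
pose s (psi : E -> R) k : R := if 0 <= psi (e k) then 3 ^- k else - 3 ^- k.
pose psi := fix psi n := if n is k.+1 then fun x => psi k x + s (psi k) k * f k x
  else fun=> 0.
have p3 k : 0 < 3 ^- k :> R by rewrite invr_gt0 exprn_gt0.
have sE k p : `|s p k| = 3 ^- k.
  by rewrite /s; case: ifP => _; rewrite ?normrN gtr0_norm.
have S3 k : 3 ^- k.+1 = 3 ^- k / 3 :> R by rewrite exprS invfM mulrC.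
(* Geometric series: the weights [3 ^- j] from [k] on sum to [3 / 2 * 3 ^- k]. From [k.+1] on,
   tested on [e k] of norm [3 ^+ k], they leave at most 1/2. *)
have tail k n x : `|psi (k + n)%N x - psi k x| <= (3 / 2) * (3 ^- k - 3 ^- (k + n)) * `|x|.
  elim: n => [|n IH]; first by rewrite addn0 !subrr normr0 mulr0 mul0r.
  rewrite addnS /=; have [[_ /(_ x) fx] _] := Hf (k + n)%N; rewrite mul1r in fx.
  have T := ler_normD (psi (k + n)%N x - psi k x) (s (psi (k + n)%N) (k + n)%N * f (k + n)%N x).
  rewrite addrAC; apply: le_trans T _.
  have : `|s (psi (k + n)%N) (k + n)%N * f (k + n)%N x| <= 3 ^- (k + n) * `|x|.
    by rewrite normrM sE ler_wpM2l// ltW.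
  rewrite S3; lra.
have psi_bf n : bounded_functional (3 / 2) (psi n).
  split=> [a x y|x].
    elim: n => [|n IH] /=; first by rewrite mulr0 addr0.
    by have [[-> _] _] := Hf n; rewrite IH; ring.
  have := tail 0%N n x; rewrite add0n subr0 => /le_trans; apply.
  by rewrite expr0 invr1 ler_wpM2r// -[leRHS]mulr1 ler_wpM2l ?divr_ge0//.
have psi_e k : 1 <= `|psi k.+1 (e k)|.
  rewrite /=; have [_ ->] := Hf k; rewrite enorm /s; case: ifP => [h|/negbT].
    rewrite mulVf ?expf_neq0// ger0_norm; lra.
  rewrite -ltNge => h; rewrite mulNr mulVf ?expf_neq0// ler0_norm; lra.
have [F FU Fn] := eventually_ultra.
have Fb : F [set n | bounded_functional (3 / 2) (psi n)].
  by apply: filterS (Fn 0%N) => n _; exact: psi_bf.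
have [phi bphi Hphi] := ultra_functional_limit FU Fb.
exists (3 / 2), phi; split=> // k.
rewrite leNgt; apply/negP => lt.
have d0 : 0 < 1 / 2 - `|phi (e k)| by rewrite subr_gt0.
have [i [/= ki H]] := filter_ex (filterI (Fn k.+1) (Hphi (e k) _ d0)).
have := tail k.+1 (i - k.+1)%N (e k); rewrite subnKC// enorm S3.
have -> : 3 / 2 * (3 ^- k / 3 - 3 ^- i) * 3 ^+ k = 1 / 2 - 3 / 2 * 3 ^- i * 3 ^+ k :> R.
  by rewrite mulrBr mulrBl; congr (_ - _); field; rewrite expf_neq0.
have : 0 < 3 / 2 * 3 ^- i * 3 ^+ k :> R by rewrite !mulr_gt0// ?exprn_gt0 ?invr_gt0.
have := psi_e k; have := lerB_dist (psi k.+1 (e k)) (psi i (e k)).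
have := lerB_dist (psi i (e k)) (phi (e k)).
rewrite [`|psi i (e k) - psi k.+1 (e k)|]distrC /= in H *; lra.
Qed.

End ultrafilter_limits.

(** * Tychonoff spaces and the point-open game *)

Section real_continuity.
Context (R : realType) (X : topologicalType).
Implicit Types f g : X -> R.

Lemma continuous_dist f : continuous f <->
  forall x (eps : R), 0 < eps -> nbhs x [set y | `|f y - f x| < eps].
Proof.
split=> [fc x eps eps0|H x].
  have /cvgrPdist_lt/(_ _ eps0) := fc x.
  by apply: filterS => y; rewrite distrC.
apply/cvgrPdist_lt => eps eps0; apply: filterS (H x _ eps0) => y /=.
by rewrite distrC.
Qed.

Lemma continuous_lt_open f (c : R) : continuous f -> open [set x | f x < c].
Proof.
move=> /continuous_dist fc; rewrite openE => x /= xc.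
apply: filterS (fc x (c - f x) _); last by rewrite subr_gt0.
by move=> y /=; rewrite ltr_norml => /andP[]; lra.
Qed.

Lemma continuous_gt_open f (c : R) : continuous f -> open [set x | c < f x].
Proof.
move=> /continuous_dist fc; rewrite openE => x /= xc.
apply: filterS (fc x (f x - c) _); last by rewrite subr_gt0.
by move=> y /=; rewrite ltr_norml => /andP[]; lra.
Qed.

Lemma continuous_norm f : continuous f -> continuous (fun x => `|f x|).
Proof.
move=> /continuous_dist fc; apply/continuous_dist => x eps e0.
apply: filterS (fc x _ e0) => y /=; apply: le_lt_trans; exact: ler_dist_dist.
Qed.

Lemma continuous_minr f g : continuous f -> continuous g ->
  continuous (fun x => Num.min (f x) (g x)).
Proof. by move=> fc gc x; exact: (continuous_min (fc x) (gc x)). Qed.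

Lemma continuous_maxr f g : continuous f -> continuous g ->
  continuous (fun x => Num.max (f x) (g x)).
Proof. by move=> fc gc x; exact: (continuous_max (fc x) (gc x)). Qed.

Lemma continuous_affine f (a b : R) : continuous f ->
  continuous (fun x => a + b * f x).
Proof.
by move=> fc x; apply: cvgD; [exact: cvg_cst|apply: cvgM; [exact: cvg_cst|exact: fc]].
Qed.

Lemma continuous_clamp f : continuous f -> exists g, [/\ continuous g,
  forall x, 0 <= g x <= 1, forall x, f x <= 0 -> g x = 0 & forall x, 1 <= f x -> g x = 1].
Proof.
move=> fc; exists (fun x => Num.max 0 (Num.min 1 (f x))); split.
- apply: continuous_maxr; first exact: cst_continuous.
  by apply: continuous_minr => //; exact: cst_continuous.
- by move=> x; rewrite le_max lexx /= ge_max ler01 ge_min lexx.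
- by move=> x fx; apply/max_idPl; rewrite ge_min fx orbT.
- by move=> x fx; rewrite (min_idPl fx); apply/max_idPr; exact: ler01.
Qed.

End real_continuity.

Section tychonoff.
Context (R : realType) (X : topologicalType).
Hypothesis tX : tychonoff_space R X.

Lemma tychonoff_separation (B : set X) (s : seq X) : closed B ->
  (forall y, y \in s -> ~ B y) ->
  exists f : X -> R, [/\ continuous f, forall x, 0 <= f x <= 1,
    forall y, y \in s -> f y = 0 & forall y, B y -> f y = 1].
Proof.
move=> cB; elim: s => [|x s IH] sB.
  exists (fun=> 1); split=> //; first exact: cst_continuous.
  by move=> x; rewrite ler01 lexx.
have [|f [fc f01 fs fB]] := IH; first by move=> y ys; apply: sB; rewrite inE ys orbT.
have [g [gc gx gB]] := tX.2 x B cB (sB x (mem_head _ _)).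
exists (fun y => Num.min (f y) `|g y|); split.
- exact/continuous_minr/continuous_norm.
- move=> y; have /andP[f0 f1] := f01 y.
  by rewrite le_min f0 normr_ge0 ge_min f1.
- move=> y; rewrite inE => /orP[/eqP ->|ys].
    by rewrite gx normr0; apply/min_idPr; have /andP[] := f01 x.
  by rewrite fs//; apply/min_idPl.
- by move=> y By; rewrite fB// gB// normr1 minxx.
Qed.

Lemma tychonoff_closed_seq (s : seq X) : closed [set x | x \in s].
Proof.
have /accessible_finite_set_closed := hausdorff_accessible tX.1.
by apply; exact: finite_seq.
Qed.

Lemma tychonoff_interpolation (s t : seq X) : (forall y, y \in s -> y \notin t) ->
  exists f : X -> R, [/\ continuous f, forall x, 0 <= f x <= 1,
    forall y, y \in s -> f y = 0 & forall y, y \in t -> f y = 1].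
Proof.
move=> st; apply: (@tychonoff_separation [set x | x \in t] s) => [|y ys /=].
  exact: tychonoff_closed_seq.
by apply/negP; exact: st.
Qed.

Lemma tychonoff_regular (x : X) (U : set X) : nbhs x U ->
  exists V : set X, [/\ open V, V x & closure V `<=` U].
Proof.
rewrite nbhsE => -[W [oW Wx] WU].
have [f [fc fx fW]] := tX.2 x (~` W) (open_closedC oW) (fun h => h Wx).
exists [set y | f y < 1 / 2]; split.
- exact: continuous_lt_open.
- by rewrite /= fx; lra.
- move=> y cy; apply: WU; apply: contrapT => nWy.
  have oy : open_nbhs y [set z | 1 / 2 < f z].
    by split; [exact: continuous_gt_open|rewrite /= fW//; lra].
  have [z [/= z1 z2]] := cy _ (open_nbhs_nbhs oy).
  by have := lt_trans z1 z2; rewrite ltxx.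
Qed.

End tychonoff.

(* Winning strategies of the first player in the point-open game: the player
   names finitely many points, the opponent answers with an open set containing
   them, and the answers must cover the target after finitely many rounds. *)
Inductive game_tree (X : Type) : Type :=
  | Leaf
  | Node of seq X & (set X -> game_tree X).
Arguments Leaf {X}.

Section point_open_game.
Context (X : topologicalType).
Implicit Types (t : game_tree X) (D : set X).

(** [D] is the part of the target still uncovered when the strategy [t] takes over. *)
Fixpoint covers t D : Prop :=
  match t with
  | Leaf => D = set0
  | Node F sub => forall U, open U -> (forall x, x \in F -> U x) ->
                  covers (sub U) (D `\` U)
  end.

Lemma covers_subset t D D' : D' `<=` D -> covers t D -> covers t D'.
Proof.
elim: t D D' => [|F sub IH] D D' sD /=; first by move=> D0; rewrite -subset0 -D0.
by move=> H U oU FU; apply: IH (H U oU FU); exact: setSD.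
Qed.

Fixpoint tree_append t1 t2 : game_tree X :=
  match t1 with
  | Leaf => t2
  | Node F sub => Node F (fun U => tree_append (sub U) t2)
  end.

Lemma covers_append t1 t2 D1 D2 : covers t1 D1 -> covers t2 D2 ->
  covers (tree_append t1 t2) (D1 `|` D2).
Proof.
elim: t1 D1 D2 => [|F sub IH] D1 D2 /=; first by move=> ->; rewrite set0U.
move=> H1 H2 U oU FU; have := IH U _ _ (H1 U oU FU) H2.
by apply: covers_subset => x [[D1x|D2x] nUx]; [left|right].
Qed.

Definition coverable D := exists t, covers t D.

(** Strategies can be played one after the other, so coverable sets form an ideal. If [C] were
    outside it, the sets [A] with [C \ A] coverable would form a proper filter, whose cluster point
    in [C] has no coverable neighbourhood. *)
Lemma compact_locally_coverable C : compact C ->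
  (forall x, C x -> exists U, [/\ open U, U x & coverable (C `&` U)]) ->
  coverable C.
Proof.
move=> cC H; apply: contrapT => nC.
pose F : set_system X := [set A | coverable (C `\` A)].
have FF : ProperFilter F.
  split; first by rewrite /F /= setD0.
  split.
  - by exists Leaf; rewrite /= setDT.
  - move=> A B [tA HA] [tB HB]; exists (tree_append tA tB).
    by rewrite setDIr; exact: covers_append.
  - move=> A B AB [tA HA]; exists tA; apply: covers_subset HA.
    exact: setDS.
have FC : F C by exists Leaf; rewrite /= setDv.
have [x [Cx clx]] := cC F FF FC.
have [U [oU Ux [t cU]]] := H x Cx.
have [y [nUy Uy]] : ~` U `&` U !=set0.
  apply: clx; last exact: open_nbhs_nbhs.
  by exists t; rewrite setDE setCK.
exact: nUy.
Qed.

(** [A] collects the points without coverable neighbourhood. Near an isolated point [x] of [A],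
    naming [x] first makes the opponent swallow the only bad point; the compact remainder is locally
    coverable, so [x] was not bad. This replaces an induction on the Cantor-Bendixson rank. *)
Lemma compact_scattered_coverable (R : realType) K : tychonoff_space R X ->
  compact K -> scattered K -> coverable K.
Proof.
move=> tX cK sK.
pose A := [set x | K x /\ forall U, open U -> U x -> ~ coverable (K `&` U)].
have notA x : K x -> ~ A x -> exists U, [/\ open U, U x & coverable (K `&` U)].
  move=> Kx nA; apply: contrapT => nU; apply: nA; split=> // U oU Ux cU.
  by apply: nU; exists U.
have [A0|A0] := pselect (A !=set0); last first.
  apply: compact_locally_coverable => // x Kx; apply: notA => // Ax.
  by apply: A0; exists x.
have [||x [/set_mem Ax [V nV VA]]] := sK A; [by move=> x []|exact: A0|].
have [W [oW Wx clW]] := tychonoff_regular tX nV.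
exfalso; have [Kx /(_ W oW Wx)] := Ax; apply.
have /choice[sub Hsub] : forall U, exists t, open U -> U x ->
    covers t ((K `&` closure W) `\` U).
  move=> U; have [[oU Ux]|nU] := pselect (open U /\ U x); last first.
    by exists Leaf => oU Ux; exfalso; apply: nU.
  suff [t Ht] : coverable ((K `&` closure W) `\` U) by exists t.
  apply: compact_locally_coverable.
    apply: (subclosed_compact _ cK); last by move=> y [[]].
    rewrite setDE; apply: closedI; last exact: open_closedC.
    by apply: closedI; [exact: compact_closed tX.1 cK|exact: closed_closure].
  move=> y [[Ky Wy] nUy].
  have [||G [oG Gy [t Ht]]] := notA y => //.
    move=> Ay; have : [set x] y by rewrite -VA; split=> //; exact: clW.
    by move=> yx; apply: nUy; rewrite yx.
  exists G; split=> //; exists t; apply: covers_subset Ht.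
  by move=> z [[[]]].
exists (Node [:: x] sub) => U oU xU /=.
apply: covers_subset (Hsub U oU (xU x (mem_head _ _))).
by apply: setSD; apply: setIS; exact: subset_closure.
Qed.

End point_open_game.

(** * From winning strategies to pointwise null sequences *)

Section strictly_frechet_urysohn.
Context (R : realType) (X : topologicalType).
Variables (K : nat -> set X) (t : nat -> game_tree X).
Hypothesis KT : forall x, exists n, K n x.
Hypothesis tK : forall n, covers (t n) (K n).

(** A position [(i, T)]: the piece [K i] is being covered and the strategy [T] remains to be played.
    At a leaf, play passes to piece [i.+1]. *)
Let state : Type := nat * game_tree X.

Let moves (s : state) : seq X := if s.2 is Node F _ then F else [::].

Let step (U : set X) (s : state) : state :=
  match s.2 with
  | Leaf => (s.1.+1, t s.1.+1)
  | Node _ sub => (s.1, sub U)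
  end.

Let mem_moves (L : seq state) s x : List.In s L -> x \in moves s ->
  x \in flatten (map moves L).
Proof.
elim: L => //= a L IH [->|sL] xs; rewrite mem_cat ?xs// IH ?orbT//.
Qed.

(* At each round the first player answers every subsequence of the previous
   rounds at once. A point missed infinitely often would then give a play,
   along the rounds that miss it, in which the strategy fails. *)
Lemma strictly_frechet_urysohn (P : nat -> (X -> R) -> Prop) :
  (forall n (F : seq X) (eps : R), 0 < eps -> exists f,
     [/\ P n f, continuous f & forall x, x \in F -> `|f x| < eps]) ->
  exists f : nat -> X -> R, (forall n, P n (f n)) /\
    forall x (eps : R), 0 < eps -> exists N, forall n, (N <= n)%N -> `|f n x| < eps.
Proof.
move=> HP; have eps0 n : 0 < n.+1%:R^-1 :> R by rewrite invr_gt0.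
have /choice[pick Hpick] : forall p : nat * seq state, exists f : X -> R,
    [/\ P p.1 f, continuous f &
        forall x, x \in flatten (map moves p.2) -> `|f x| < p.1.+1%:R^-1].
  by move=> [n L]; exact: HP.
pose U (f : X -> R) n : set X := [set x | `|f x| < n.+1%:R^-1].
pose L := fix L n := if n is k.+1 then
  L k ++ map (step (U (pick (k, L k)) k)) (L k) else [:: (0%N, t 0%N)].
pose f n := pick (n, L n).
have Lstep n s : List.In s (L n) -> List.In (step (U (f n) n) s) (L n.+1).
  by move=> sL; apply/List.in_app_iff; right; exact: List.in_map.
have Lmono n m s : (n <= m)%N -> List.In s (L n) -> List.In s (L m).
  move=> /subnKC <- sL; elim: (m - n)%N => [|k IH]; first by rewrite addn0.
  by rewrite addnS; apply/List.in_app_iff; left.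
have advance T i n : List.In (i, T) (L n) -> exists m, List.In (i.+1, t i.+1) (L m).
  elim: T n => [|F sub IH] n /Lstep; first by exists n.+1.
  by move=> /IH.
have reach i : exists n, List.In (i, t i) (L n).
  elim: i => [|i [n /advance//]]; by exists 0%N; left.
exists f; split=> [n|x eps e0]; first by case: (Hpick (n, L n)).
apply: contrapT => nN.
have missed N : exists2 n, (N <= n)%N & ~ U (f n) n x.
  apply: contrapT => nU; apply: nN.
  have [M _ HM] : \forall n \near \oo, n.+1%:R^-1 < eps by exact: near_infty_natSinv_lt (PosNum e0).
  exists (maxn N M) => n; rewrite geq_max => /andP[Nn Mn].
  apply: lt_trans (HM n Mn); apply: contrapT => nUn; apply: nU.
  by exists n.
(* Induction on the tree: at a later round that misses [x] the position advances while [x] stays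
   uncovered, down to a leaf, where nothing may be left uncovered. *)
have kill T D : covers T D -> D x -> forall n i, ~ List.In (i, T) (L n).
  elim: T D => [|F sub IH] D; first by move=> /= ->.
  move=> cD Dx n i iL; have [m nm nU] := missed n.
  have {}iL := Lmono _ _ _ nm iL.
  have [_ fc fF] := Hpick (m, L m).
  apply: (IH (U (f m) m) (D `\` U (f m) m)) (Lstep _ _ iL) => //.
  apply: cD; first by apply: (@continuous_lt_open _ _ (fun x => `|f m x|)); exact: continuous_norm.
  by move=> y yF; apply: fF; exact: mem_moves iL _.
have [i Kix] := KT x; have [n iL] := reach i.
exact: kill (tK i) Kix _ _ iL.
Qed.

End strictly_frechet_urysohn.

(** * Homeomorphisms between C_p(X) and E_w *)

Section filters.
Context (T : Type) (F : set_system T) {FF : Filter F}.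

Lemma filter_forall_lt (n : nat) (P : nat -> set T) :
  (forall i, (i < n)%N -> F (P i)) -> F [set x | forall i, (i < n)%N -> P i x].
Proof.
elim: n => [|n IH] H; first by apply: filterS filterT => x _ i; rewrite ltn0.
have Fn := IH (fun i lt => H i (ltnW lt)).
apply: filterS (filterI Fn (H n (ltnSn n))) => x [H1 H2] i.
by rewrite ltnS leq_eqVlt => /orP[/eqP ->//|]; exact: H1.
Qed.

Lemma filter_forall_seq (I : eqType) (s : seq I) (P : I -> set T) :
  (forall i, i \in s -> F (P i)) -> F [set x | forall i, i \in s -> P i x].
Proof.
elim: s => [|a s IH] H; first by apply: filterS filterT => x _ i.
have Fs := IH (fun i si => H i (mem_behead (si : i \in behead (a :: s)))).
apply: filterS (filterI (H a (mem_head _ _)) Fs) => x [Ha Hs] i.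
by rewrite inE => /orP[/eqP ->//|]; exact: Hs.
Qed.

End filters.

Section pointwise_topology.
Context (R : realType) (I : Type).

Lemma ptws_nbhs_eval (f : {ptws I -> R}) i (eps : R) : 0 < eps ->
  nbhs f [set g : {ptws I -> R} | `|g i - f i| < eps].
Proof.
move=> eps0.
have /cvg_sup/(_ i) H : f --> f by exact: cvg_id.
apply: H; apply: (@initial_continuous _ R (fun g : prod_topology (fun _ : I => R) => g i) f
  [set y | `|y - f i| < eps]).
apply: filterS (nbhsx_ballx (f i) eps eps0) => y.
by rewrite -ball_normE /= distrC.
Qed.

Lemma ptws_filter_cvg (F : set_system (I -> R)) (f : {ptws I -> R}) : Filter F ->
  (forall i (eps : R), 0 < eps -> F [set g | `|g i - f i| < eps]) -> F --> f.
Proof.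
move=> FF H; apply/cvg_sup => i A [_ [[B oB <-] Bf sB]].
have /nbhs_ballP[eps /= eps0 beps] : nbhs (f i) B by exact: open_nbhs_nbhs.
apply: filterS (H i eps eps0) => g /= gi; apply: sB; apply: beps.
by rewrite -ball_normE /= distrC.
Qed.

End pointwise_topology.

Section weak_neighbourhoods.
Context (R : realType) (E : normedModType R).

(** One number [n] bounds both how many functionals occur and their norms, and the radius is fixed
    at 1; this makes the later family of pieces countable. *)
Definition weak_nbhs (e0 : E) : set_system E :=
  [set A | exists n (phi : nat -> E -> R),
    (forall i, (i < n)%N -> bounded_functional n%:R (phi i)) /\
    (forall e, (forall i, (i < n)%N -> `|phi i (e - e0)| < 1) -> A e)].

Lemma weak_nbhs_filter e0 : Filter (weak_nbhs e0).
Proof.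
split.
- by exists 0%N, (fun _ _ => 0).
- move=> A B [n [phi [bphi HA]]] [m [psi [bpsi HB]]].
  exists (n + m)%N, (fun i => if (i < n)%N then phi i else psi (i - n)%N); split.
    move=> i im; case: ifPn => [lt|]; last rewrite -leqNgt => le.
      by apply: bounded_functional_weaken (bphi i lt); rewrite ler_nat leq_addr.
    apply: bounded_functional_weaken (bpsi (i - n)%N _); last by rewrite ltn_subLR.
    by rewrite ler_nat leq_addl.
  move=> e He; split.
    apply: HA => i lt; have := He i; rewrite lt; apply.
    exact: leq_trans lt (leq_addr _ _).
  apply: HB => i lt; have := He (n + i)%N; rewrite ltn_add2l => /(_ lt).
  by rewrite ltnNge leq_addr /= addnC addnK.
- move=> A B AB [n [phi [bphi HA]]]; exists n, phi; split=> // e He.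
  exact/AB/HA.
Qed.
#[local] Existing Instance weak_nbhs_filter.

Lemma weak_nbhs_functional e0 M phi (eps : R) : bounded_functional M phi ->
  0 < eps -> weak_nbhs e0 [set e | `|phi e - phi e0| < eps].
Proof.
(* Dividing [phi] by [eps] turns the radius into 1; [n] bounds the norm of the quotient and is
   positive, so that index 0 is available. *)
move=> bphi eps0; set n := (Num.trunc (`|M| / eps)).+1.
have nM : `|M| / eps <= n%:R.
  by apply: ltW; exact: truncnS_gt.
exists n, (fun=> fun e => eps^-1 * phi e); split=> [i _|e /(_ 0%N isT)].
  split=> [a x y|e]; first by rewrite bphi.1; ring.
  rewrite normrM gtr0_norm ?invr_gt0// ler_pdivrMl//.
  apply: le_trans (bphi.2 e) _; rewrite mulrA ler_wpM2r//.
  by apply: le_trans (ler_norm _) _; rewrite -ler_pdivrMl// mulrC.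
rewrite /= (bounded_functionalB _ _ bphi) normrM gtr0_norm ?invr_gt0//.
by rewrite ltr_pdivrMl// mulr1.
Qed.

Lemma weak_nbhs_cvg (e0 : E) : weak_nbhs e0 --> (e0 : weak_topology E).
Proof.
move=> A [_ [[B oB <-] Be sB]].
have nB : nbhs (weak_eval e0) B by exact: open_nbhs_nbhs.
have H : (@weak_eval R E) @ weak_nbhs e0 --> weak_eval e0.
  apply: ptws_filter_cvg => phi eps eps0.
  have [M _ bphi] := cont_dual_bounded phi.
  exact: (weak_nbhs_functional _ bphi).
exact: filterS sB (H B nB).
Qed.

Lemma weak_nbhs_eval (e0 : weak_topology E) (phi : cont_dual E) (eps : R) :
  0 < eps -> nbhs e0 [set e : weak_topology E | `|cd_fun phi e - cd_fun phi e0| < eps].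
Proof.
move=> eps0; apply: (@initial_continuous _ _ (@weak_eval R E) e0
  [set g | `|g phi - cd_fun phi e0| < eps]).
exact: (@ptws_nbhs_eval _ _ (weak_eval e0)).
Qed.

End weak_neighbourhoods.
#[local] Existing Instance weak_nbhs_filter.

Section pointwise_weak_homeomorphism.
Context (R : realType) (E : completeNormedModType R) (X : topologicalType).

(* The homeomorphism of C_p(X) with E_w, with both continuities spelled out on
   the standard bases: finitely many points, finitely many functionals. *)
Record pointwise_weak_homeo (T : (X -> R) -> E) (S : E -> X -> R) : Prop := {
  pwhK : forall f, continuous f -> S (T f) = f ;
  pwh_continuous : forall e, continuous (S e) ;
  pwhVK : forall e, T (S e) = e ;
  pwhV_cont : forall e0 x (eps : R), 0 < eps ->
    weak_nbhs e0 [set e | `|S e x - S e0 x| < eps] ;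
  pwh_cont : forall f0, continuous f0 -> forall M phi, bounded_functional M phi ->
    forall eps : R, 0 < eps -> exists (Y : seq X) (eta : R), 0 < eta /\
    forall f, continuous f -> (forall y, y \in Y -> `|f y - f0 y| < eta) ->
    `|phi (T f) - phi (T f0)| < eps }.

Lemma Cp_weak_homeomorphism_pointwise (T : {ptws X -> R} -> weak_topology E) :
  Cp_weak_homeomorphism T -> exists S, pointwise_weak_homeo T S.
Proof.
move=> [S [ST Sc TS Tc Scont]]; exists S; split.
- by move=> f fc; exact: ST.
- exact: Sc.
- exact: TS.
- move=> e0 x eps eps0.
  have H : nbhs (S e0) [set g : {ptws X -> R} | `|g x - S e0 x| < eps].
    exact: ptws_nbhs_eval.
  exact: (weak_nbhs_cvg (Scont e0 _ H)).
- move=> f0 f0c M phi bphi eps eps0.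
  have [psi psiE] := bounded_cont_dual bphi.
  have H := @weak_nbhs_eval R E (T f0) psi eps eps0; rewrite psiE in H.
  have /subspace_continuousP/(_ f0 f0c) := Tc => /(_ _ H).
  rewrite /= withinE => -[A nA AE].
  pose G : set_system (X -> R) := [set B | exists (Y : seq X) (eta : R), 0 < eta /\
    forall f, (forall y, y \in Y -> `|f y - f0 y| < eta) -> B f].
  have FG : Filter G.
    split.
    + by exists [::], 1.
    + move=> B C [Y [eta [eta0 HB]]] [Z [d [d0 HC]]].
      exists (Y ++ Z), (Num.min eta d); split; first by rewrite lt_min eta0.
      move=> f Hf; split; [apply: HB|apply: HC] => y yY; have := Hf y;
        by rewrite mem_cat yY ?orbT lt_min => /(_ isT)/andP[].
    + move=> B C BC [Y [eta [eta0 HB]]]; exists Y, eta; split=> // f Hf.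
      exact/BC/HB.
  have : G --> (f0 : {ptws X -> R}).
    apply: ptws_filter_cvg => x d d0; exists [:: x], d; split=> // f /(_ x).
    by apply; exact: mem_head.
  move=> /(_ A nA)[Y [eta [eta0 HY]]]; exists Y, eta; split=> // f fc fY.
  have : (A `&` @Cp_set R X) f by split=> //; exact: HY.
  by rewrite -AE => -[].
Qed.

Section basics.
Variables (T : (X -> R) -> E) (S : E -> X -> R).
Hypothesis TS : pointwise_weak_homeo T S.

(** Conjugation by the affine self-homeomorphism [f -> g0 + r * f] of C_p(X) and a translation of
    [E]; the new map sends 0 to 0. *)
Lemma pointwise_weak_homeo_recenter (g0 : X -> R) (r : R) : continuous g0 -> 0 < r ->
  pointwise_weak_homeo (fun f => T (fun x => g0 x + r * f x) - T g0)
                       (fun e x => (S (e + T g0) x - g0 x) / r).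
Proof.
move=> g0c r0; have rn0 : r != 0 by rewrite gt_eqF.
have comb f : continuous f -> continuous (fun x => g0 x + r * f x).
  move=> fc x; apply: cvgD; first exact: g0c.
  by apply: cvgM; [exact: cvg_cst|exact: fc].
split.
- move=> f fc; apply/funext => x; rewrite subrK (pwhK TS (comb f fc)).
  by field.
- move=> e x; apply: cvgM; last exact: cvg_cst.
  by apply: cvgB; [exact: (pwh_continuous TS)|exact: g0c].
- move=> e; rewrite [X in T X](_ : _ = S (e + T g0)) ?(pwhVK TS) ?addrK//.
  by apply/funext => x; field.
- move=> e0 x eps eps0.
  have [n [phi [bphi H]]] := pwhV_cont TS (e0 + T g0) x (mulr_gt0 eps0 r0).
  exists n, phi; split=> // e He.
  rewrite /= -mulrBl opprB addrA subrK normrM [X in _ * X]gtr0_norm ?invr_gt0//.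
  rewrite ltr_pdivrMr//; apply: H => i lt.
  by rewrite opprD addrACA subrr addr0; exact: He.
- move=> f0 f0c M phi bphi eps eps0.
  have [Y [eta [eta0 H]]] := pwh_cont TS (comb _ f0c) bphi eps0.
  exists Y, (eta / r); split; first by rewrite divr_gt0.
  move=> f fc fY; rewrite !(bounded_functionalB _ _ bphi).
  rewrite opprB addrA subrK; apply: H; first exact: comb.
  move=> y yY; rewrite opprD addrACA subrr add0r -mulrBr normrM gtr0_norm//.
  by rewrite -ltr_pdivlMl// mulrC; exact: fY.
Qed.

(* The condition [k < |T f|] is open for pointwise convergence, so a failure
   at every scale produces nested sup-norm balls whose limit would have
   infinite norm. *)
Lemma pointwise_weak_homeo_locally_bounded : exists (g0 : X -> R) (r C : R),
  [/\ continuous g0, 0 < r &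
   forall f, continuous f -> (forall x, `|f x - g0 x| <= r) -> `|T f| <= C].
Proof.
apply: contrapT => nex.
pose inv (p : (X -> R) * R) := continuous p.1 /\ 0 < p.2.
have /choice[next Hnext] : forall q : nat * ((X -> R) * R), exists p,
    inv q.2 -> [/\ inv p, p.2 <= q.2.2 / 2, forall x, `|p.1 x - q.2.1 x| <= q.2.2 / 2 &
      forall f, continuous f -> (forall x, `|f x - p.1 x| <= p.2) -> q.1%:R < `|T f|].
  move=> [k [g r]] /=; have [[/= gc r0]|ninv] := pselect (inv (g, r)); last by exists (g, r).
  have [f [fc fg fk]] : exists f, [/\ continuous f, forall x, `|f x - g x| <= r / 2 &
      k%:R < `|T f|].
    apply: contrapT => nf; apply: nex; exists g, (r / 2), k%:R; split=> //.
      by rewrite divr_gt0.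
    move=> f fc fg; rewrite leNgt; apply/negP => lt; apply: nf; exists f.
    by split.
  have [phi bphi phiE] := hahn_banach_norming (T f).
  have d0 : 0 < `|T f| - k%:R by rewrite subr_gt0.
  have [Y [eta [eta0 H]]] := pwh_cont TS fc bphi d0.
  (* Radius [r / 2] keeps the new ball inside the old one; [eta / 2 < eta] keeps the norming
     functional [phi], hence [|T h|], above [k] on all of it. *)
  exists (f, Num.min (r / 2) (eta / 2)) => _; split=> //=.
  - by split=> //=; rewrite lt_min !divr_gt0.
  - by rewrite ge_min lexx.
  - move=> h hc hf; have := bphi.2 (T h); rewrite mul1r; apply: lt_le_trans.
    have : `|phi (T h) - phi (T f)| < `|T f| - k%:R.
      apply: H => // y _; apply: le_lt_trans (hf y) _.
      by rewrite gt_min; apply/orP; right; lra.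
    rewrite phiE; have := ler_norm (phi (T h)).
    by rewrite ltr_norml => ? /andP[]; lra.
pose seqp := fix seqp n := if n is k.+1 then next (k, seqp k) else (fun=> 0, 1).
have Hinv n : inv (seqp n).
  elim: n => [|n IH]; first by split=> //=; exact: cst_continuous.
  by have [] := Hnext (n, seqp n) IH.
pose g n := (seqp n).1; pose r n := (seqp n).2.
have r0 n : 0 < r n by case: (Hinv n).
have gc n : continuous (g n) by case: (Hinv n).
have Hn n : [/\ r n.+1 <= r n / 2, forall x, `|g n.+1 x - g n x| <= r n / 2 &
    forall f, continuous f -> (forall x, `|f x - g n.+1 x| <= r n.+1) -> n%:R < `|T f|].
  by have [] := Hnext (n, seqp n) (Hinv n).
have gm k m x : `|g (k + m)%N x - g k x| <= r k - r (k + m)%N.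
  elim: m => [|m IH]; first by rewrite addn0 !subrr normr0.
  rewrite addnS; have [H1 H2 _] := Hn (k + m)%N; have := H2 x.
  have := ler_distD (g (k + m)%N x) (g (k + m).+1 x) (g k x); lra.
have rle n : r n <= 2^-1 ^+ n.
  elim: n => [|n IH]; first by rewrite expr0.
  by have [H _ _] := Hn n; rewrite exprSr; lra.
have [F FU Fn] := eventually_ultra.
have /choice[h Hh] : forall x, exists l, forall eps : R, 0 < eps ->
    F [set n | `|g n x - l| < eps].
  move=> x; apply: (@ultra_bounded_cvg _ _ _ _ (r 0%N)) => //.
  apply: filterS (Fn 0%N) => n _ /=; have := gm 0%N n x.
  rewrite add0n {2}/g /= subr0; have := r0 n; lra.
have hg k x : `|h x - g k x| <= r k.
  rewrite leNgt; apply/negP => lt.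
  have d0 : 0 < `|h x - g k x| - r k by rewrite subr_gt0.
  have [m [/= km H]] := filter_ex (filterI (Fn k) (Hh x _ d0)).
  have := gm k (m - k)%N x; rewrite subnKC//; have := r0 m.
  have := ler_distD (g m x) (h x) (g k x); rewrite [`|h x - g m x|]distrC; lra.
have hc : continuous h.
  apply/continuous_dist => x eps eps0.
  have [k rk] : exists k, r k < eps / 3.
    have e30 : 0 < eps / 3 by rewrite divr_gt0.
    have [k _ Hk] : \forall k \near \oo, (2^-1 : R) ^+ k < eps / 3.
      have /cvgrPdist_lt/(_ _ e30) : (fun k : nat => (2^-1 : R) ^+ k) @ \oo --> (0 : R).
        by apply: cvg_expr; rewrite ger0_norm; lra.
      by apply: filterS => k; rewrite sub0r normrN ger0_norm// exprn_ge0.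
    by exists k; apply: le_lt_trans (rle k) (Hk k (leqnn k)).
  have /continuous_dist/(_ x _ (divr_gt0 eps0 (ltr0n _ 3))) := gc k.
  apply: filterS => y /= gy.
  have := hg k x; have := hg k y; have := ler_distD (g k y) (h y) (h x).
  have := ler_distD (g k x) (g k y) (h x); rewrite [`|g k x - h x|]distrC; lra.
have big n : n%:R < `|T h| by have [_ _] := Hn n; apply.
by have := truncnS_gt `|T h|; have := big (Num.trunc `|T h|).+1; lra.
Qed.

End basics.

End pointwise_weak_homeomorphism.

(** * The compact pieces *)

Section compact_pieces.
Context (R : realType) (E : completeNormedModType R) (X : topologicalType).
Variables (T : (X -> R) -> E) (S : E -> X -> R).
Hypothesis TS : pointwise_weak_homeo T S.
Hypothesis T0 : T (fun=> 0) = 0.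
Hypothesis tX : tychonoff_space R X.

Definition piece (n : nat) : set X := [set x | exists phi : nat -> E -> R,
  (forall i, (i < n)%N -> bounded_functional n%:R (phi i)) /\
  forall e, (forall i, (i < n)%N -> `|phi i e| < 1) -> `|S e x| <= 1].

Lemma pwhV0 x : S 0 x = 0.
Proof. by rewrite -T0 (pwhK TS)//; exact: cst_continuous. Qed.

Lemma piece_cover : \bigcup_n piece n = [set: X].
Proof.
rewrite -subTset => x _.
have [n [phi [bphi H]]] := pwhV_cont TS 0 x ltr01.
exists n => //; exists phi; split=> // e He.
have /H : forall i, (i < n)%N -> `|phi i (e - 0)| < 1 by rewrite subr0.
by rewrite /= pwhV0 subr0; exact: ltW.
Qed.

Lemma pwh_cont_finite n (phi : nat -> E -> R) M (eps : R) :
  (forall i, (i < n)%N -> bounded_functional M (phi i)) -> 0 < eps ->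
  exists (Y : seq X) (eta : R), 0 < eta /\
    forall f, continuous f -> (forall y, y \in Y -> `|f y| < eta) ->
    forall i, (i < n)%N -> `|phi i (T f)| < eps.
Proof.
move=> bphi eps0; elim: n bphi => [|n IH] bphi.
  by exists [::], 1; split=> // f _ _ i; rewrite ltn0.
have [Y [eta [eta0 HY]]] := IH (fun i lt => bphi i (ltnW lt)).
have bn := bphi n (ltnSn n).
have c0 : continuous (fun _ : X => 0 : R) by exact: cst_continuous.
have [Z [d [d0 HZ]]] := pwh_cont TS c0 bn eps0.
exists (Y ++ Z), (Num.min eta d); split; first by rewrite lt_min eta0.
move=> f fc fYZ i; rewrite ltnS leq_eqVlt => /orP[/eqP ->|lt].
  have := HZ f fc; rewrite T0 (bounded_functional0 bn) subr0; apply => y yZ.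
  have := fYZ y; rewrite mem_cat yZ orbT subr0 lt_min.
  by move=> /(_ isT)/andP[].
apply: HY => // y yY; have := fYZ y; rewrite mem_cat yY lt_min.
by move=> /(_ isT)/andP[].
Qed.

(** For an ultrafilter on the piece, the controlling tuples converge to a tuple [psi]. Continuity of
    [T] at 0 tests [psi] on finitely many points [Y], and one of them must be the limit: otherwise a
    function vanishing on [Y] and large on a set of [F] contradicts the control. The limit is
    controlled by [psi]. *)
Lemma piece_compact n : compact (piece n).
Proof.
rewrite compact_ultra => F FU Fn.
have /choice[phi Hphi] : forall x, exists phi : nat -> E -> R, piece n x ->
    (forall i, (i < n)%N -> bounded_functional n%:R (phi i)) /\
    forall e, (forall i, (i < n)%N -> `|phi i e| < 1) -> `|S e x| <= 1.
  move=> x; have [[phi H]|nx] := pselect (piece n x); first by exists phi.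
  by exists (fun _ _ => 0).
have /choice[psi Hpsi] : forall i, exists psi : E -> R, (i < n)%N ->
    bounded_functional n%:R psi /\
    forall e (eps : R), 0 < eps -> F [set x | `|phi x i e - psi e| < eps].
  move=> i; have [lt|ge] := ltnP i n; last by exists (fun=> 0).
  have Fi : F [set x | bounded_functional n%:R (phi x i)].
    by apply: filterS Fn => x /Hphi[H _]; exact: H.
  by have [psi ? ?] := ultra_functional_limit FU Fi; exists psi.
have FS e : (forall i, (i < n)%N -> `|psi i e| < 1) -> F [set x | `|S e x| <= 1].
  move=> He; have Fall : F [set x | forall i, (i < n)%N -> `|phi x i e| < 1].
    apply: filter_forall_lt => i lt.
    have d0 : 0 < 1 - `|psi i e| by rewrite subr_gt0; exact: He.
    apply: filterS ((Hpsi i lt).2 e _ d0) => x /=.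
    by have := lerB_dist (phi x i e) (psi i e); lra.
  by apply: filterS (filterI Fn Fall) => x [/Hphi[_ H] /H].
have [Y [eta [eta0 HY]]] := pwh_cont_finite (fun i lt => (Hpsi i lt).1) ltr01.
have [y yY Fy] : exists2 y, y \in Y & F --> y.
  apply: contrapT => nF.
  have [C [cC FC CY]] : exists C : set X, [/\ closed C, F C & forall y, y \in Y -> ~ C y].
    have : forall y, y \in Y -> ~ F --> y by move=> y yY Fy; apply: nF; exists y.
    elim: Y {nF HY} => [|a Y IH] H.
      by exists setT; split=> //; exact: filterT.
    have [|C [cC FC CY]] := IH; first by move=> y yY; apply: H; rewrite inE yY orbT.
    have [U [oU Ua nU]] : exists U, [/\ open U, U a & ~ F U].
      apply: contrapT => nU; apply: (H a (mem_head _ _)) => V.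
      rewrite nbhsE => -[W [oW Wa] WV]; apply: filterS WV _.
      by apply: contrapT => nW; apply: nU; exists W.
    exists (C `&` ~` U); split.
    - by apply: closedI => //; exact: open_closedC.
    - by apply: filterI => //; have [] := in_ultra_setVsetC U FU.
    - by move=> y; rewrite inE => /orP[/eqP -> [_]//|/CY nC []].
  have [f [fc f01 fY fC]] := tychonoff_separation tX cC CY.
  (* The value 2 on [C] exceeds the bound 1 of [FS]. *)
  have gc : continuous (fun x => 0 + 2 * f x) by exact: continuous_affine.
  have /FS : forall i, (i < n)%N -> `|psi i (T (fun x => 0 + 2 * f x))| < 1.
    by apply: HY => // y yY; rewrite fY// mulr0 addr0 normr0.
  rewrite (pwhK TS gc) => FS2.
  have [x [/= Cx]] := filter_ex (filterI FC FS2).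
  by rewrite fC// add0r mulr1 ger0_norm; lra.
exists y; split=> //; exists psi; split=> [i lt|e He]; first exact: (Hpsi i lt).1.
rewrite leNgt; apply/negP => lt.
have ny : nbhs y [set x | 1 < `|S e x|].
  apply: open_nbhs_nbhs; split=> //.
  apply: (@continuous_gt_open _ _ (fun x => `|S e x|)).
  exact/continuous_norm/(pwh_continuous TS).
have [x [/= x1 x2]] := filter_ex (filterI (Fy _ ny) (FS e He)).
by have := lt_le_trans x1 x2; rewrite ltxx.
Qed.

Hypothesis infX : ~ finite_set [set: X].

(* Otherwise a weak neighbourhood of 0 would be norm bounded, hence |.| would be
   dominated by finitely many functionals; then T maps the unbounded ray k * f
   to a sequence with a norm convergent ultralimit. *)
Lemma sphere_meets_weak_nbhs (U : set E) (r : R) : weak_nbhs 0 U -> 0 < r ->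
  exists2 e, U e & `|e| = r.
Proof.
move=> [n [phi [bphi HU]]] r0; apply: contrapT => nex.
have lt_r e : (forall i, (i < n)%N -> `|phi i e| < 1) -> `|e| < r.
  move=> He; rewrite ltNge; apply/negP => re.
  have e0 : 0 < `|e| by apply: lt_le_trans re.
  apply: nex; exists ((r / `|e|) *: e); last first.
    by rewrite normrZ ger0_norm ?divr_ge0 ?(ltW r0)// divfK ?gt_eqF.
  apply: HU => i lt; rewrite subr0 (bounded_functionalZ _ _ (bphi i lt)) normrM.
  rewrite ger0_norm ?divr_ge0 ?(ltW r0)//.
  apply: le_lt_trans (He i lt); rewrite -[leRHS]mul1r ler_wpM2r//.
  by rewrite ler_pdivrMr// mul1r.
have dominated e (d : R) : 0 < d -> (forall i, (i < n)%N -> `|phi i e| < d) -> `|e| < r * d.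
  move=> d0 He; have := lt_r (d^-1 *: e); rewrite normrZ gtr0_norm ?invr_gt0//.
  rewrite ltr_pdivrMl// mulrC; apply=> i lt.
  rewrite (bounded_functionalZ _ _ (bphi i lt)) normrM gtr0_norm ?invr_gt0//.
  by rewrite ltr_pdivrMl// mulr1; exact: He.
have [Y [eta [eta0 HY]]] := pwh_cont_finite bphi ltr01.
have [x xY] : exists x, x \notin Y.
  apply: contrapT => nx; apply: infX; apply: sub_finite_set (finite_seq Y) => x _ /=.
  by apply: contrapT => /negP xY; apply: nx; exists x.
have YC y : y \in Y -> y \notin [:: x].
  by move=> yY; rewrite inE; apply: contraNneq xY => <-.
have [f [fc _ fY fx]] := tychonoff_interpolation tX YC.
pose e (k : nat) := T (fun x => 0 + k%:R * f x).
have kfc (k : nat) : continuous (fun x => 0 + k%:R * f x) by exact: continuous_affine.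
have eb k i : (i < n)%N -> `|phi i (e k)| < 1.
  by apply: HY => // y yY; rewrite fY// mulr0 addr0 normr0.
have [F FU Fn] := eventually_ultra.
have /choice[l Hl] : forall i, exists l : R, (i < n)%N -> forall eps : R, 0 < eps ->
    F [set k | `|phi i (e k) - l| < eps].
  move=> i; have [lt|ge] := ltnP i n; last by exists 0.
  have Fi : F [set k | `|phi i (e k)| <= 1].
    by apply: filterS (Fn 0%N) => k _; apply/ltW/eb.
  by have [l Hl] := ultra_bounded_cvg FU Fi; exists l.
have : cvg (e @ F).
  apply: cauchy_cvg; apply: cauchy_exP => eps eps0.
  pose d := eps / r; have d0 : 0 < d by rewrite divr_gt0.
  have Fd : F [set k | forall i, (i < n)%N -> `|phi i (e k) - l i| < d / 2].
    by apply: filter_forall_lt => i lt; apply: Hl => //; rewrite divr_gt0.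
  have [k0 Hk0] := filter_ex Fd; exists (e k0).
  suff : F (e @^-1` ball (e k0) eps) by [].
  apply: filterS Fd => k /= Hk.
  rewrite -ball_normE /=; have -> : eps = r * d by rewrite mulrC divfK// gt_eqF.
  apply: dominated => // i lt; rewrite (bounded_functionalB _ _ (bphi i lt)).
  have := Hk0 i lt; have := Hk i lt; have := ler_distD (l i) (phi i (e k0)) (phi i (e k)).
  rewrite [`|l i - phi i (e k)|]distrC; lra.
move=> /cvg_ex[/= a ea].
(* Continuity of [S] at the limit [a] puts [S (e k) x = k] within 1 of [S a x] for [F]-many [k],
   which fails for large [k]. *)
have [m [psi [bpsi Hm]]] := pwhV_cont TS a x ltr01.
have Fm : F [set k | forall i, (i < m)%N -> `|psi i (e k - a)| < 1].
  apply: filter_forall_lt => i lt; have bi := bpsi i lt.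
  have d0 : 0 < m%:R^-1 :> R by rewrite invr_gt0 ltr0n; case: (m) lt.
  have /ea : nbhs a (ball a m%:R^-1) by exact: nbhsx_ballx.
  rewrite /= -ball_normE => Fb.
  have {}Fb : F [set k | `|a - e k| < m%:R^-1] by exact: Fb.
  apply: filterS Fb => k /= ak; apply: le_lt_trans (bi.2 _) _.
  rewrite distrC; have m0 : 0 < m%:R :> R by rewrite -invr_gt0.
  by rewrite -ltr_pdivlMl// mulr1.
set c := S a x in Hm.
have [k [/= Hk ck]] := filter_ex (filterI Fm (Fn (Num.trunc (`|c| + 1)).+1)).
have := Hm _ Hk; rewrite /= /e (pwhK TS (kfc k)) fx ?mem_head// mulr1 add0r.
have : `|c| + 1 < k%:R by apply: lt_le_trans (truncnS_gt _) _; rewrite ler_nat.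
have := ler_norm c; rewrite ltr_norml => ? ? /andP[]; lra.
Qed.

Lemma piece_not_scattered : exists n, ~ scattered (piece n).
Proof.
apply: contrapT => nex.
have /choice[t tP] : forall n, exists t, covers t (piece n).
  move=> n; apply: (compact_scattered_coverable tX); first exact: piece_compact.
  by apply: contrapT => ns; apply: nex; exists n.
have PT x : exists n, piece n x.
  have : [set: X] x by []; by rewrite -piece_cover => -[n _ ?]; exists n.
have [|f [fP f0]] := @strictly_frechet_urysohn R X piece t PT tP
    (fun n f => continuous f /\ `|T f| = 3 ^+ n).
  move=> n F eps eps0.
  have FU : weak_nbhs 0 [set e | forall x, x \in F -> `|S e x - S 0 x| < eps].
    apply: (@filter_forall_seq _ (weak_nbhs 0) _ _ F) => x _.
    exact: (pwhV_cont TS).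
  have [e He en] := sphere_meets_weak_nbhs FU (exprn_gt0 n (ltr0n R 3)).
  exists (S e); split; [by split; [exact: (pwh_continuous TS)|rewrite (pwhVK TS)]| |].
    exact: (pwh_continuous TS).
  by move=> x xF; have := He x xF; rewrite /= pwhV0 subr0.
have [M [phi [_ bphi phie]]] :=
  exponential_growth_not_weakly_null (fun n => (fP n).2).
have c0 : continuous (fun _ : X => 0 : R) by exact: cst_continuous.
(* The tolerance 1/2 is the lower bound in [phie]; convergence of [f n] to 0 on the finite set [Y]
   violates it. *)
have [Y [eta [eta0 HY]]] := pwh_cont TS c0 bphi (ltac:(lra) : 0 < 1 / 2 :> R).
have [n Hn] : exists n, forall y, y \in Y -> `|f n y| < eta.
  suff [N HN] : exists N, forall n, (N <= n)%N -> forall y, y \in Y -> `|f n y| < eta.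
    by exists N; exact: HN.
  elim: (Y) => [|a s [N HN]]; first by exists 0%N.
  have [M' HM'] := f0 a eta eta0; exists (maxn N M') => n.
  rewrite geq_max => /andP[Nn Mn] y; rewrite inE => /orP[/eqP ->|]; first exact: HM'.
  exact: HN.
have := HY (f n) (fP n).1; rewrite T0 (bounded_functional0 bphi) subr0.
move=> H; have := phie n; rewrite leNgt H// => y yY.
by rewrite subr0; exact: Hn.
Qed.

End compact_pieces.

(** * Cantor schemes and independent functions *)

Section cantor_scheme.
Context (R : realType) (X : topologicalType).
Hypothesis tX : tychonoff_space R X.

Let open_setD_point (U : set X) x : open U -> open (U `\` [set x]).
Proof.
move=> oU; rewrite setDE; apply: openI => //; apply: closed_openC.
have /accessible_finite_set_closed := hausdorff_accessible tX.1.
by apply; exact: finite_set1.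
Qed.

Section crowded.
Variable A : set X.
Hypothesis crowded : forall x, ~ isolated A x.

Lemma crowded_avoid (s : seq X) (U : set X) : open U -> U `&` A !=set0 ->
  exists a, [/\ U a, A a & a \notin s].
Proof.
elim: s U => [|x s IH] U oU [a [Ua Aa]]; first by exists a.
have [y [[Uy nyx] Ay]] : (U `\` [set x]) `&` A !=set0.
  have [ax|ax] := pselect (a = x); last by exists a.
  apply: contrapT => nex; apply: (@crowded a); split; first exact/mem_set.
  exists U; first exact: open_nbhs_nbhs.
  apply/seteqP; split=> [z [Uz Az]|z ->] //=.
  apply: contrapT => za; apply: nex; exists z; split=> //; split=> //.
  by rewrite -ax.
have [||b [[Ub nbx] Ab bs]] := IH (U `\` [set x]); first exact: open_setD_point.
  by exists y.
exists b; split=> //; rewrite inE negb_or bs andbT.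
by apply/eqP.
Qed.

(** Two points of [A] are chosen in each open set, all zeros distinct from all ones, so that one
    interpolating function splits every cell of a level at once. *)
Lemma crowded_split (Us : seq (set X)) :
  (forall U, List.In U Us -> open U /\ U `&` A !=set0) ->
  exists f : X -> R, continuous f /\ forall U, List.In U Us ->
    (U `&` [set x | f x < 1 / 4]) `&` A !=set0 /\
    (U `&` [set x | 3 / 4 < f x]) `&` A !=set0.
Proof.
move=> HUs.
have [zs [os [zo H]]] : exists zs os : seq X, (forall y, y \in zs -> y \notin os) /\
    forall U, List.In U Us -> (exists a, [/\ a \in zs, U a & A a]) /\
                              (exists b, [/\ b \in os, U b & A b]).
  elim: Us HUs => [|U Us IH] HUs; first by exists [::], [::].
  have [|zs [os [zo H]]] := IH; first by move=> V VUs; apply: HUs; right.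
  have [oU UA] := HUs U (or_introl erefl).
  have [a [Ua Aa aos]] := crowded_avoid os oU UA.
  have [b [Ub Ab bzs]] := crowded_avoid (a :: zs) oU UA.
  exists (a :: zs), (b :: os); split.
    move=> y yzs; rewrite inE negb_or; apply/andP; split.
      by apply: contraNneq bzs => <-.
    by move: yzs; rewrite inE => /orP[/eqP ->|/zo].
  move=> V [<-|/H[[a' [? ? ?]] [b' [? ? ?]]]].
    by split; [exists a|exists b]; rewrite mem_head.
  by split; [exists a'|exists b']; rewrite inE; split=> //; apply/orP; right.
have [f [fc _ f0 f1]] := tychonoff_interpolation tX zo.
exists f; split=> // U /H[[a [az Ua Aa]] [b [bo Ub Ab]]]; split.
  by exists a; split=> //; split=> //=; rewrite f0//; lra.
by exists b; split=> //; split=> //=; rewrite f1//; lra.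
Qed.

End crowded.

(** The cells [W s n] along a branch [s] decrease and meet [A]; compactness gives a cluster point
    [t s]. It satisfies only the non-strict inequalities, which clamping turns into the exact values
    0 and 1. *)
Lemma compact_not_scattered_cantor (K : set X) : compact K -> ~ scattered K ->
  exists (f : nat -> X -> R) (t : (nat -> bool) -> X),
  [/\ forall n, continuous (f n), forall n x, 0 <= f n x <= 1, forall s, K (t s) &
      forall s n, f n (t s) = (s n)%:R].
Proof.
move=> cK nK.
have [A [AK [a0 Aa0] crowded]] : exists A : set X,
    [/\ A `<=` K, A !=set0 & forall x, ~ isolated A x].
  apply: contrapT => nA; apply: nK => A AK A0; apply: contrapT => niso.
  by apply: nA; exists A; split=> // x xi; apply: niso; exists x.
pose good (Us : seq (set X)) := forall U, List.In U Us -> open U /\ U `&` A !=set0.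
have /choice[pick Hpick] : forall Us, exists f : X -> R, good Us ->
    continuous f /\ forall U, List.In U Us ->
    (U `&` [set x | f x < 1 / 4]) `&` A !=set0 /\
    (U `&` [set x | 3 / 4 < f x]) `&` A !=set0.
  move=> Us; have [gU|] := pselect (good Us); last by exists (fun=> 0).
  by have [f Hf] := crowded_split crowded gU; exists f.
pose side (b : bool) (h : X -> R) : set X :=
  if b then [set x | 3 / 4 < h x] else [set x | h x < 1 / 4].
pose L := fix L n := if n is k.+1 then
  map (fun U => U `&` side false (pick (L k))) (L k) ++
  map (fun U => U `&` side true (pick (L k))) (L k) else [:: setT].
pose h n := pick (L n).
have Lgood n : good (L n).
  elim: n => [|n IH]; first by move=> U [<-|//]; split; [exact: openT|exists a0].
  have [hc hU] := Hpick _ IH.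
  move=> U /List.in_app_iff[] /List.in_map_iff[V [<- VL]]; have [oV _] := IH V VL;
    have [hV1 hV2] := hU V VL; split=> //; apply: openI => //.
  - exact: continuous_lt_open.
  - exact: continuous_gt_open.
have hc n : continuous (h n) by case: (Hpick _ (Lgood n)).
pose W (s : nat -> bool) := fix W n := if n is k.+1 then W k `&` side (s k) (h k)
  else setT.
have WL s n : List.In (W s n) (L n).
  elim: n => [|n IH]; first by left.
  apply/List.in_app_iff; rewrite /=; case: (s n); [right|left].
    exact: (List.in_map (fun U => U `&` side true (pick (L n)))).
  exact: (List.in_map (fun U => U `&` side false (pick (L n)))).
have Wside s n m : (n < m)%N -> W s m `<=` side (s n) (h n).
  elim: m => // m IH; rewrite ltnS leq_eqVlt => /orP[/eqP -> x []//|lt].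
  by move=> x [Wx _]; exact: (IH lt x Wx).
have /choice[t tP] : forall s : nat -> bool, exists p, K p /\
    forall n, if s n then 3 / 4 <= h n p else h n p <= 1 / 4.
  move=> s.
  have /choice[a aP] : forall n, exists a, (W s n `&` A) a.
    by move=> n; have [_ [a ?]] := Lgood n _ (WL s n); exists a.
  have FK : (a @ \oo) K by exists 0%N => // n _; apply: AK; case: (aP n).
  have [p [Kp clp]] := cK (a @ \oo) _ FK.
  exists p; split=> // n.
  have Fn : (a @ \oo) (side (s n) (h n)).
    exists n.+1 => // m /= nm; apply: (Wside s n m nm).
    by case: (aP m).
  case: (s n) Fn => Fn; rewrite leNgt; apply/negP => lt.
    have [y [/= y1 y2]] := clp _ _ Fn (open_nbhs_nbhs (conj
      (continuous_lt_open (3 / 4) (hc n)) lt)).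
    by have := lt_trans y1 y2; rewrite ltxx.
  have [y [/= y1 y2]] := clp _ _ Fn (open_nbhs_nbhs (conj
    (continuous_gt_open (1 / 4) (hc n)) lt)).
  by have := lt_trans y1 y2; rewrite ltxx.
have /choice[f fP] : forall n, exists g : X -> R, [/\ continuous g,
    forall x, 0 <= g x <= 1, forall x, h n x <= 1 / 4 -> g x = 0 &
    forall x, 3 / 4 <= h n x -> g x = 1].
  (* The affine map [- (1 / 2) + 2 * h] sends the thresholds 1/4 and 3/4 to 0 and 1. *)
  move=> n; have [g [gc g01 g0 g1]] :=
    continuous_clamp (@continuous_affine _ _ _ (- (1 / 2)) 2 (hc n)).
  by exists g; split=> // x hx; [apply: (g0 x)|apply: (g1 x)]; rewrite /=; lra.
exists f, t; split=> [n|n|s|s n].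
- by case: (fP n).
- by case: (fP n).
- by case: (tP s).
- have [_ /(_ n)] := tP s; have [_ _ f0 f1] := fP n.
  by case: (s n) => hn; [rewrite f1|rewrite f0].
Qed.

End cantor_scheme.

(** * Uncountable subsets of the Cantor space *)

Section uncountable_sets.
Local Notation C := (nat -> bool).
Implicit Types (P : set C) (F : C -> seq C).

Lemma uncountable_cantor : ~ countable [set: C].
Proof.
move=> /countable_injP[f finj].
(* Cantor's diagonal, transported through the injection [f]. *)
pose d : C := fun n => `[< exists2 c, f c = n & c n = false >].
have dF : d (f d) = false.
  apply/negbTE/negP => dd; have /asboolP[c fc cn] := dd.
  have cd : c = d by apply: finj => //; exact/mem_set.
  by move: cn; rewrite cd dd.
by move: (dF) => /asboolP; apply; exists d.
Qed.

Lemma uncountable_subset P Q : P `<=` Q -> ~ countable P -> ~ countable Q.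
Proof. by move=> PQ nP cQ; apply: nP; exact: sub_countable (subset_card_le PQ) cQ. Qed.

Lemma uncountable_nonempty P : ~ countable P -> P !=set0.
Proof.
move=> nP; apply: contrapT => /nonemptyPn P0; apply: nP.
by rewrite P0; exact: countable0.
Qed.

Lemma uncountable_bigcup P (Q : nat -> set C) : ~ countable P ->
  P `<=` \bigcup_n Q n -> exists n, ~ countable (P `&` Q n).
Proof.
move=> nP PQ; apply: contrapT => nex.
apply: (@uncountable_subset P (\bigcup_n (P `&` Q n))) => //.
  by move=> x Px; have [n _ Qx] := PQ x Px; exists n.
apply: bigcup_countable => // n _; apply: contrapT => nc.
by apply: nex; exists n.
Qed.

Lemma uncountable_setD P Q : ~ countable P -> countable Q -> ~ countable (P `\` Q).
Proof.
move=> nP cQ cD; apply: (@uncountable_subset P (\bigcup_(b : bool) if b then Q else P `\` Q)) => //.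
  by move=> x Px; have [Qx|nQx] := pselect (Q x); [exists true|exists false].
by apply: bigcup_countable => // -[].
Qed.

(** There are countably many cylinders; without a condensation point, those meeting [P] in a
    countable set would cover [P]. *)
Lemma condensation_point P : ~ countable P ->
  exists2 p, P p & forall m, ~ countable [set r | P r /\ mkseq p m = mkseq r m].
Proof.
move=> nP; apply: contrapT => nex.
pose cyl (w : seq bool) := [set r | P r /\ w = mkseq r (size w)].
apply: (@uncountable_subset P (\bigcup_(w in [set w | countable (cyl w)]) cyl w)) => //.
  move=> p Pp; apply: contrapT => np; apply: nex; exists p => // m cm.
  apply: np; exists (mkseq p m); last by split; rewrite ?size_mkseq.
  rewrite /= /cyl size_mkseq; exact: cm.
by apply: bigcup_countable => //; exact: countableP.
Qed.

(* A weak form of the Delta-system lemma, with root D. *)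
Lemma uncountable_delta k P F : ~ countable P ->
  (forall r, P r -> (size (F r) <= k)%N) ->
  exists P' (D : seq C), [/\ P' `<=` P, ~ countable P' &
    forall q, q \notin D -> countable [set r | P' r /\ q \in F r]].
Proof.
elim: k P F => [|k IH] P F nP Fk.
  exists P, [::]; split=> // q _; rewrite (_ : [set _ | _] = set0) ?countable0//.
  by apply/seteqP; split=> // r [/Fk]; rewrite leqn0 => /eqP/size0nil ->.
have [[q nq]|nq] := pselect (exists q, ~ countable [set r | P r /\ q \in F r]); last first.
  exists P, [::]; split=> // q _; apply: contrapT => cq.
  by apply: nq; exists q.
(* Some [q] lies in uncountably many [F r]: it joins the root and is deleted from these sets, whose
   size drops. *)
pose F' r := [seq x <- F r | predC (pred1 q) x].
have [|P' [D [P'P nP' HP']]] := IH _ F' nq.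
  move=> r [/Fk kr qr]; rewrite size_filter -ltnS; apply: leq_trans kr.
  by rewrite -(count_predC (pred1 q)) -[ltnLHS]add0n ltn_add2r -has_count has_pred1.
exists P', (q :: D); split=> //; first by move=> r /P'P[].
move=> q'; rewrite inE negb_or => /andP[q'q /HP'].
by apply: sub_countable; apply: subset_card_le => r [? ?]; split=> //; rewrite mem_filter /= q'q.
Qed.

Lemma mkseq_le (p q : C) m n : (m <= n)%N -> mkseq p n = mkseq q n -> mkseq p m = mkseq q m.
Proof.
move=> mn /(congr1 (take m)).
by rewrite /mkseq -!map_take !take_iota (minn_idPl mn).
Qed.

Lemma mkseq_separates (p q : C) : p <> q -> exists m, mkseq p m <> mkseq q m.
Proof.
move=> pq; apply: contrapT => nm; apply: pq; apply/funext => n.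
have /(congr1 (fun s => nth false s n)) : mkseq p n.+1 = mkseq q n.+1.
  by apply: contrapT => h; apply: nm; exists n.+1.
by rewrite !nth_mkseq.
Qed.

(** [ps] holds a condensation point of each [P], so uncountably many [r] stay close to [ps] at any
    depth. As [ps] avoids the root, all but countably many [F r] miss [ps]; each of these is
    separated from [ps] at some depth, and one depth serves uncountably many [r]. *)
Lemma uncountable_split P0 (D : seq C) F (Ps : seq (set C)) :
  (forall q, q \notin D -> countable [set r | P0 r /\ q \in F r]) ->
  (forall P, List.In P Ps -> ~ countable P /\ P `<=` P0 `\` [set r | r \in D]) ->
  exists (ps : seq C) (m : nat), forall P, List.In P Ps ->
    ~ countable [set r | P r /\ exists2 p, p \in ps & mkseq p m = mkseq r m] /\
    ~ countable [set r | P r /\ forall q p, q \in F r -> p \in ps -> mkseq p m <> mkseq q m].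
Proof.
move=> HD HPs.
have [ps [psD Hps]] : exists ps : seq C, (forall p, p \in ps -> p \notin D) /\
    forall P, List.In P Ps -> exists2 p, p \in ps &
      forall m, ~ countable [set r | P r /\ mkseq p m = mkseq r m].
  elim: Ps HPs => [|P Ps IH] HPs; first by exists [::].
  have [|ps [psD Hps]] := IH; first by move=> Q QPs; apply: HPs; right.
  have [nP PP0] := HPs P (or_introl erefl).
  have [p Pp cp] := condensation_point nP.
  exists (p :: ps); split.
    move=> q; rewrite inE => /orP[/eqP ->|/psD//].
    by have [_ /= /negP] := PP0 _ Pp.
  move=> Q [<-|/Hps[q qps cq]]; first by exists p; rewrite ?mem_head.
  by exists q; rewrite ?inE ?qps ?orbT.
pose Z P m := [set r | P r /\ forall q p, q \in F r -> p \in ps -> mkseq p m <> mkseq q m].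
have ZS P m n : (m <= n)%N -> Z P m `<=` Z P n.
  move=> mn r [Pr H]; split=> // q p qF pps /(mkseq_le mn); exact: H.
have HZ P : List.In P Ps -> exists m, ~ countable (Z P m).
  move=> /HPs[nP PP0].
  pose bad := \bigcup_(p in [set p | p \in ps]) [set r | P0 r /\ p \in F r].
  have cbad : countable bad.
    apply: bigcup_countable; first exact/finite_set_countable/finite_seq.
    by move=> p /= pps; apply/HD/psD.
  have [|m Hm] := @uncountable_bigcup (P `\` bad) (Z P) (uncountable_setD nP cbad).
    move=> r [Pr nbad].
    have [m Hm] : exists m, forall q p, q \in F r -> p \in ps -> mkseq p m <> mkseq q m.
      have : forall q, q \in F r -> q \notin ps.
        move=> q qF; apply/negP => qps; apply: nbad; exists q => //; split=> //.
        by case: (PP0 _ Pr).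
      elim: (F r) => [|q s IH] Hs; first by exists 0%N.
      have [|m1 Hm1] := IH; first by move=> q' q's; apply: Hs; rewrite inE q's orbT.
      have {Hs IH}qps := Hs q (mem_head _ _).
      have [m2 Hm2] : exists m, forall p, p \in ps -> mkseq p m <> mkseq q m.
        elim: (ps) qps => [|p s' IH]; first by exists 0%N.
        rewrite inE negb_or => /andP[/eqP qp /IH[m Hm]].
        have [m' Hm'] := mkseq_separates (nesym qp); exists (maxn m m') => p'.
        rewrite inE => /orP[/eqP -> /(mkseq_le (leq_maxr _ _))//|/Hm H].
        by move=> /(mkseq_le (leq_maxl _ _)).
      exists (maxn m1 m2) => q' p; rewrite inE => /orP[/eqP ->|q's] pps.
        by move=> /(mkseq_le (leq_maxr _ _)); exact: Hm2.
      by move=> /(mkseq_le (leq_maxl _ _)); exact: Hm1.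
    by exists m.
  by exists m; apply: uncountable_subset Hm => r [].
have [m Hm] : exists m, forall P, List.In P Ps -> ~ countable (Z P m).
  elim: Ps HZ {HPs Hps} => [|P Ps IH] HZ; first by exists 0%N.
  have [|m1 Hm1] := IH; first by move=> Q QPs; apply: HZ; right.
  have [m2 Hm2] := HZ P (or_introl erefl).
  exists (maxn m1 m2) => Q [<-|/Hm1 nQ].
    exact: uncountable_subset (ZS P _ _ (leq_maxr _ _)) Hm2.
  exact: uncountable_subset (ZS Q _ _ (leq_maxl _ _)) nQ.
exists ps, m => P PPs; split; last exact: Hm.
have [p pps /(_ m)] := Hps P PPs; apply: uncountable_subset => r [Pr pr].
by split=> //; exists p.
Qed.

End uncountable_sets.

(** * Independent functions along a Cantor scheme *)

Section independent_functions.
Context (R : realType) (X : topologicalType).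
Local Notation C := (nat -> bool).
Variables (f : nat -> X -> R) (t : C -> X) (Y : C -> seq X).
Hypothesis fc : forall n, continuous (f n).
Hypothesis ft : forall s n, f n (t s) = (s n)%:R.

(** Extends the inverse of [t] to all of [X]: the code of [t s] is [s]. *)
Let code (y : X) : C := fun i => 1 / 2 < f i y.

Let bump1 (p : C) m : exists g : X -> R, [/\ continuous g, forall x, 0 <= g x <= 1,
  forall r, mkseq p m = mkseq r m -> g (t r) = 1 &
  forall y, mkseq p m <> mkseq (code y) m -> g y = 0].
Proof.
elim: m => [|m [g [gc g01 g1 g0]]].
  exists (fun=> 1); split=> //; first exact: cst_continuous.
  by move=> x; rewrite ler01 lexx.
(* The affine map is [2 * f m - 1] or [1 - 2 * f m]: it is 1 where [f m] equals the bit [p m], and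
   at most 0 across the threshold 1/2. *)
have [h [hc h01 h0 h1]] := continuous_clamp (@continuous_affine _ _ _
  (if p m then - 1 else 1) (if p m then 2 else - 2) (@fc m)).
exists (fun x => Num.min (g x) (h x)); split.
- exact: continuous_minr.
- move=> x; have /andP[? ?] := g01 x; have /andP[? ?] := h01 x.
  by rewrite le_min ge_min; apply/andP; split; apply/andP || apply/orP; [|left].
- move=> r pr; rewrite g1; last exact: mkseq_le (leqnSn m) pr.
  rewrite h1 ?minxx// ft.
  have /(congr1 (fun s => nth false s m)) := pr; rewrite !nth_mkseq// => ->.
  by case: (r m) => /=; lra.
- move=> y py; have [pym|pym] := pselect (mkseq p m = mkseq (code y) m); last first.
    by rewrite g0//; apply/min_idPl; case/andP: (h01 y).
  rewrite h0; first by apply/min_idPr; case/andP: (g01 y).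
  have : p m <> code y m.
    move=> pm; apply: py; rewrite /mkseq -addn1 iotaD !map_cat /= add0n pm.
    by congr (_ ++ _).
  by rewrite /code; case: (p m); case: ltP => /= fy H; (try by exfalso; apply: H); lra.
Qed.

Let bump (ps : seq C) m : exists g : X -> R, [/\ continuous g, forall x, 0 <= g x <= 2,
  forall r, (exists2 p, p \in ps & mkseq p m = mkseq r m) -> g (t r) = 2 &
  forall y, (forall p, p \in ps -> mkseq p m <> mkseq (code y) m) -> g y = 0].
Proof.
have [g [gc g01 g1 g0]] : exists g : X -> R, [/\ continuous g, forall x, 0 <= g x <= 1,
  forall r, (exists2 p, p \in ps & mkseq p m = mkseq r m) -> g (t r) = 1 &
  forall y, (forall p, p \in ps -> mkseq p m <> mkseq (code y) m) -> g y = 0].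
  elim: ps => [|p ps [g [gc g01 g1 g0]]].
    exists (fun=> 0); split=> //; first exact: cst_continuous.
      by move=> x; rewrite lexx ler01.
    by move=> r [].
  have [h [hc h01 h1 h0]] := bump1 p m.
  exists (fun x => Num.max (g x) (h x)); split.
  - exact: continuous_maxr.
  - move=> x; have /andP[? ?] := g01 x; have /andP[? ?] := h01 x.
    by rewrite le_max ge_max; apply/andP; split; [apply/orP; left|apply/andP].
  - move=> r [q]; rewrite inE => /orP[/eqP -> /h1 ->|qps qr].
      by apply/max_idPr; case/andP: (g01 (t r)).
    by rewrite g1; [apply/max_idPl; case/andP: (h01 (t r))|exists q].
  - move=> y Hy; rewrite h0; last by apply: Hy; rewrite mem_head.
    by rewrite g0 ?maxxx// => q qps; apply: Hy; rewrite inE qps orbT.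
(* The height 2 beats the bound 1 in the definition of a piece. *)
exists (fun x => 0 + 2 * g x); split.
- exact: continuous_affine.
- by move=> x; have /andP[? ?] := g01 x; lra.
- by move=> r /g1 ->; rewrite mulr1 add0r.
- by move=> y /g0 ->; rewrite mulr0 addr0.
Qed.

(** After thinning, the sets of codes of [Y r] have bounded size and a common root [D]. Each new
    function splits all current uncountable sets of indices at once, so every finite pattern keeps
    uncountably many realisations. *)
Lemma independent_functions : exists g : nat -> X -> R,
  [/\ forall n, continuous (g n), forall n x, 0 <= g n x <= 2 &
      forall n (s : nat -> bool), exists r, forall i, (i < n)%N ->
        if s i then g i (t r) = 2 else forall y, y \in Y r -> g i y = 0].
Proof.
pose F r := map code (Y r).
have [|k nk] := @uncountable_bigcup setT (fun k => [set r | (size (F r) <= k)%N])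
    uncountable_cantor.
  by move=> r _; exists (size (F r)) => /=.
have [|P0 [D [_ nP0 HD]]] := @uncountable_delta k _ F nk; first by move=> r [].
pose P1 := P0 `\` [set r | r \in D].
have nP1 : ~ countable P1.
  by apply: uncountable_setD => //; exact/finite_set_countable/finite_seq.
pose A (h : X -> R) (b : bool) : set C :=
  [set r | if b then h (t r) = 2 else forall y, y \in Y r -> h y = 0].
pose good (Ps : seq (set C)) := forall P, List.In P Ps -> ~ countable P /\ P `<=` P1.
have /choice[pick Hpick] : forall Ps, exists h : X -> R,
    [/\ continuous h, forall x, 0 <= h x <= 2 & good Ps ->
      forall P, List.In P Ps -> forall b, ~ countable (P `&` A h b)].
  move=> Ps; have [gPs|ngood] := pselect (good Ps); last first.
    exists (fun=> 0); split=> //; first exact: cst_continuous.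
    by move=> x; rewrite lexx ler0n.
  have [ps [m Hm]] := uncountable_split HD gPs.
  have [h [hc h02 h2 h0]] := bump ps m.
  exists h; split=> // _ P /Hm[n1 n2] [].
    by apply: uncountable_subset n1 => r [Pr /h2].
  apply: uncountable_subset n2 => r [Pr Hr]; split=> // y yY.
  by apply: h0 => p pps; apply: Hr => //; exact: map_f.
pose L := fix L n := if n is k.+1 then
  map (fun P => P `&` A (pick (L k)) true) (L k) ++
  map (fun P => P `&` A (pick (L k)) false) (L k) else [:: P1].
have Lgood n : good (L n).
  elim: n => [|n IH]; first by move=> P [<-|//]; split.
  have [_ _ /(_ IH) H] := Hpick (L n).
  move=> P /List.in_app_iff[] /List.in_map_iff[Q [<- QL]]; split;
    [exact: H|by move=> r [Qr _]; apply: (IH Q QL).2|exact: H|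
     by move=> r [Qr _]; apply: (IH Q QL).2].
pose W (s : nat -> bool) := fix W n := if n is k.+1 then W k `&` A (pick (L k)) (s k)
  else P1.
have WL s n : List.In (W s n) (L n).
  elim: n => [|n IH]; first by left.
  apply/List.in_app_iff; rewrite /=; case: (s n); [left|right].
    exact: (List.in_map (fun P => P `&` A (pick (L n)) true)).
  exact: (List.in_map (fun P => P `&` A (pick (L n)) false)).
exists (fun n => pick (L n)); split.
- by move=> n; case: (Hpick (L n)).
- by move=> n; case: (Hpick (L n)).
- move=> n s; have [nW _] := Lgood n _ (WL s n).
  have [r Wr] := uncountable_nonempty nW; exists r.
  elim: n Wr {nW} => // n IH [/IH H Ar] i; rewrite ltnS leq_eqVlt.
  by move=> /orP[/eqP ->//|/H].
Qed.

End independent_functions.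

(** * Rosenthal's dichotomy *)

(* A well-founded certificate that a labelled finite set cannot be extended
   along the ultrafilter to an independent one. *)
Inductive refutation : Type :=
  | RBase
  | RStep of bool & set nat & (nat -> refutation).

Section rosenthal_dichotomy.
Context (Omega : Type) (k : nat) (A : nat -> nat -> set Omega) (B : nat -> set Omega).
Context (U : set_system nat) {UU : UltraFilter U}.
Hypothesis Uinf : forall n, U [set i | (n <= i)%N].
Local Notation node := (seq (nat * bool)).

Let sat c (s : node) (w : Omega) : Prop :=
  forall p, p \in s -> if p.2 then A c p.1 w else B p.1 w.

Let sat_cons c s n (b : bool) w : (if b then A c n w else B n w) -> sat c s w ->
  sat c ((n, b) :: s) w.
Proof. by move=> Hb Hs p; rewrite inE => /orP[/eqP -> //|]; exact: Hs. Qed.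

Let refutes c := fix refutes (s : node) (t : refutation) : Prop :=
  match t with
  | RBase => forall w, ~ sat c s w
  | RStep b Q sub => U Q /\ forall n, Q n -> refutes ((n, b) :: s) (sub n)
  end.

Let refutable c s := exists t, refutes c s t.

(** Otherwise [U]-many extensions are refutable, and their certificates assemble into an [RStep]
    refuting [s]. *)
Let not_refutable_extend c s b : ~ refutable c s ->
  U [set n | ~ refutable c ((n, b) :: s)].
Proof.
move=> ns; have [UQ|//] := in_ultra_setVsetC [set n | refutable c ((n, b) :: s)] UU.
have /choice[sub Hsub] : forall n, exists t, refutable c ((n, b) :: s) ->
    refutes c ((n, b) :: s) t.
  move=> n; have [[t Ht]|nt] := pselect (refutable c ((n, b) :: s)); first by exists t.
  by exists RBase.
by exfalso; apply: ns; exists (RStep b [set n | refutable c ((n, b) :: s)] sub).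
Qed.

(** Indices are picked so that no node of the finite tree built so far becomes refutable; a node
    that is not refutable is satisfied by some point, or [RBase] would refute it. *)
Lemma not_refutable_independent c : ~ refutable c [::] ->
  exists N : nat -> nat, forall n (s : nat -> bool), exists w, forall i, (i < n)%N ->
    if s i then A c (N i) w else B (N i) w.
Proof.
move=> nref.
have /choice[pick Hpick] : forall L : seq node, exists n,
    (forall s, s \in L -> ~ refutable c s) ->
    forall s, s \in L -> forall b, ~ refutable c ((n, b) :: s).
  move=> L; have [HL|nL] := pselect (forall s, s \in L -> ~ refutable c s); last first.
    by exists 0%N.
  have /filter_ex[n Hn] : U [set n | forall s, s \in L -> forall b,
      ~ refutable c ((n, b) :: s)].
    apply: (@filter_forall_seq _ U _ _ L) => s /HL ns.
    apply: filterS (filterI (not_refutable_extend true ns) (not_refutable_extend false ns)).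
    by move=> n [? ?] [].
  by exists n.
pose L := fix L n := if n is j.+1 then
  L j ++ map (cons (pick (L j), true)) (L j) ++ map (cons (pick (L j), false)) (L j)
  else [:: [::]].
pose N n := pick (L n); exists N => n s.
have HL m x : x \in L m -> ~ refutable c x.
  elim: m x => [|m IH] x; first by rewrite inE => /eqP ->.
  rewrite !mem_cat => /or3P[/IH//|/mapP[y yL ->]|/mapP[y yL ->]]; exact: Hpick.
pose path m : node := rev (mkseq (fun i => (N i, s i)) m).
have pathL m : path m \in L m.
  elim: m => [|m IH]; first by rewrite inE.
  rewrite /path /mkseq -addn1 iotaD map_cat rev_cat /= add0n.
  rewrite addn1 /= !mem_cat; apply/or3P.
  case: (s m); [apply: Or32|apply: Or33]; exact: map_f.
have [w Hw] : exists w, sat c (path n) w.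
  apply: contrapT => nw; apply: (HL _ _ (pathL n)); exists RBase => w sw.
  by apply: nw; exists w.
exists w => i lt; apply: (Hw (N i, s i)).
by rewrite mem_rev; apply/mapP; exists i => //; rewrite mem_iota.
Qed.

(** A colour, the labelled indices already used, and the certificate still to be followed. *)
Let entry : Type := nat * node * refutation.

Let entry_valid (e : entry) := refutes e.1.1 e.1.2 e.2.

Let entry_allows (n : nat) (e : entry) : Prop := if e.2 is RStep _ Q _ then Q n else True.

Let entry_step (n : nat) (e : entry) : entry :=
  if e.2 is RStep b _ sub then (e.1.1, (n, b) :: e.1.2, sub n) else e.

Let entry_step_valid n e : entry_valid e -> entry_allows n e -> entry_valid (entry_step n e).
Proof. by case: e => [[c s] [|b Q sub]] //= [_ H] /H. Qed.

(* If every colour is refutable, the certificates can be followed simultaneously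
   along a single increasing sequence; a point alternating along it between
   the two kinds of sets survives some certificate. *)
Lemma refutable_contradiction : (forall c, (c < k)%N -> refutable c [::]) ->
  (forall s : nat -> bool, exists w, forall n,
     if s n then exists2 c, (c < k)%N & A c n w else B n w) -> False.
Proof.
move=> href real.
have /choice[root Hroot] : forall c, exists t, (c < k)%N -> refutes c [::] t.
  move=> c; have [lt|ge] := ltnP c k; last by exists RBase.
  by have [t Ht] := href c lt; exists t.
have /choice[pick Hpick] : forall q : seq entry * nat, exists n, (q.2 < n)%N /\
    ((forall e, List.In e q.1 -> entry_valid e) -> forall e, List.In e q.1 -> entry_allows n e).
  move=> [L m] /=.
  suff /filter_ex[n [? ?]] : U ([set n | (m < n)%N] `&`
      [set n | (forall e, List.In e L -> entry_valid e) ->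
               forall e, List.In e L -> entry_allows n e]) by exists n.
  apply: filterI; first exact: Uinf.
  elim: L => [|a L IH]; first by apply: filterS (Uinf 0%N) => n _ _ e [].
  have [va|nva] := pselect (entry_valid a); last first.
    by apply: filterS (Uinf 0%N) => n _ H; exfalso; apply: nva; apply: H; left.
  have Ua : U [set n | entry_allows n a].
    case: a va => [[c s] [|b Q sub]] /=; first by move=> _; exact: filterS (Uinf 0%N).
    by case.
  apply: filterS (filterI IH Ua) => n [H1 H2] H e [<-//|eL].
  by apply: H1 => // e' e'L; apply: H; right.
(* Each round keeps every entry and adds its advanced copy, so that a certificate can wait for a
   suitable index; [pick] meets all sets [Q] at once. *)
pose st := fix st n := if n is j.+1 then
    ((st j).1 ++ map (entry_step (pick (st j))) (st j).1, pick (st j))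
  else (map (fun c => (c, [::], root c)) (iota 0 k), 0%N).
pose L n := (st n).1; pose N n := pick (st n).
have Lvalid n e : List.In e (L n) -> entry_valid e.
  elim: n e => [|n IH] e.
    move=> /List.in_map_iff[c [<- ck]]; apply: Hroot.
    have : c \in iota 0 k.
      elim: (iota 0 k) ck => //= a l IH [->|/IH]; rewrite inE ?eqxx//.
      by move=> ->; rewrite orbT.
    by rewrite mem_iota.
  move=> /List.in_app_iff[/IH//|/List.in_map_iff[a [<- aL]]].
  apply: entry_step_valid; first exact: IH.
  by have [_ /(_ IH)] := Hpick (st n); apply.
have Lallows n e : List.In e (L n) -> entry_allows (N n) e.
  by have [_ /(_ (Lvalid n))] := Hpick (st n); apply.
have Lstep n e : List.In e (L n) -> List.In (entry_step (N n) e) (L n.+1).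
  by move=> eL; apply/List.in_app_iff; right; exact: List.in_map.
have Lmono n m e : (n <= m)%N -> List.In e (L n) -> List.In e (L m).
  move=> /subnKC <- eL; elim: (m - n)%N => [|j IH]; first by rewrite addn0.
  by rewrite addnS; apply/List.in_app_iff; left.
have Nlt n : (N n < N n.+1)%N by case: (Hpick (st n.+1)).
have Ninj : injective N.
  move=> i j ij; case: (ltngtP i j) => // lt;
    by have := homo_ltn ltn_trans Nlt lt; rewrite ij ltnn.
(* The pattern asks for some [A] at the odd terms of [N] and for [B] at the even ones. *)
pose s m := `[< exists2 i, N i = m & odd i >].
have sN i : s (N i) = odd i.
  apply/asboolP/idP => [[j /Ninj ->]//|oi]; by exists i.
have [w Hw] := real s.
(* Pigeonhole: one of the finitely many colours recurs infinitely often at odd terms. *)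
have [c ck Hc] : exists2 c, (c < k)%N & forall n, exists2 i, (n <= i)%N & A c (N i) w.
  apply: contrapT => nc.
  have [M HM] : exists M, forall c, (c < k)%N -> forall i, (M <= i)%N -> ~ A c (N i) w.
    have : forall c, (c < k)%N -> exists M, forall i, (M <= i)%N -> ~ A c (N i) w.
      move=> c ck; apply: contrapT => nM; apply: nc; exists c => // n.
      apply: contrapT => ni; apply: nM; exists n => i ni' Ai; apply: ni.
      by exists i.
    elim: (k) => [|j IH] H; first by exists 0%N.
    have [M1 HM1] := IH (fun c ck => H c (ltnW ck)).
    have [M2 HM2] := H j (ltnSn j).
    exists (maxn M1 M2) => c; rewrite ltnS leq_eqVlt => /orP[/eqP ->|lt] i;
      rewrite geq_max => /andP[? ?]; [exact: HM2|exact: HM1].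
  have := Hw (N M.*2.+1); rewrite sN /= odd_double /= => -[c ck].
  apply: HM => //; by rewrite -addnn -addnS leq_addr.
have hit b n : exists2 i, (n <= i)%N & if b then A c (N i) w else B (N i) w.
  case: b; first exact: Hc.
  exists n.*2; first by rewrite -addnn leq_addr.
  by have := Hw (N n.*2); rewrite sN odd_double.
have kill t x n : List.In (c, x, t) (L n) -> sat c x w -> False.
  elim: t x n => [|b Q sub IH] x n eL xw; first exact: (Lvalid _ _ eL w).
  have [i ni Hi] := hit b n; have {}eL := Lmono _ _ _ ni eL.
  exact: (IH _ _ _ (Lstep _ _ eL) (sat_cons Hi xw)).
apply: (kill (root c) [::] 0%N) => //.
apply: (List.in_map (fun c => (c, [::], root c))).
have : c \in iota 0 k by rewrite mem_iota.
elim: (iota 0 k) => //= a l IH; rewrite inE.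
by move=> /orP[/eqP ->|/IH]; [left|right].
Qed.

End rosenthal_dichotomy.

Lemma rosenthal_dichotomy (Omega : Type) (k : nat) (A : nat -> nat -> set Omega)
    (B : nat -> set Omega) :
  (forall s : nat -> bool, exists w, forall n,
     if s n then exists2 c, (c < k)%N & A c n w else B n w) ->
  exists2 c, (c < k)%N & exists N : nat -> nat, forall n (s : nat -> bool),
    exists w, forall i, (i < n)%N -> if s i then A c (N i) w else B (N i) w.
Proof.
move=> real; have [U UU Uinf] := eventually_ultra.
apply: contrapT => nex; apply: (@refutable_contradiction Omega k A B U UU Uinf) => //.
move=> c ck; apply: contrapT => nref; apply: nex; exists c => //.
exact: (not_refutable_independent nref).
Qed.

(** * Copies of l_1 *)

Section ell1_embedding.
Context (R : realType) (E : completeNormedModType R).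
Implicit Types u v : nat -> R.

Lemma ell1_norm_le u (M : R) : (forall n, \sum_(k < n) `|u k| <= M) ->
  ell1 u /\ ell1_norm u <= M.
Proof.
move=> H.
have cu : ell1 u.
  apply: nondecreasing_is_cvgn; first by apply: nondecreasing_series => n _ _.
  exists M => _ [n _ <-]; rewrite seriesEord; exact: H.
split=> //; apply: limr_le; first exact: cu.
by apply: nearW => n; rewrite seriesEord; exact: H.
Qed.

Lemma ell1_bounded u (M : R) : (forall n, \sum_(k < n) `|u k| <= M) -> ell1 u.
Proof. by move=> /ell1_norm_le[]. Qed.

Lemma ell1_partial_sum u n : ell1 u -> \sum_(k < n) `|u k| <= ell1_norm u.
Proof.
move=> cu.
have mono : {homo series (fun k => `|u k|) : n m / (n <= m)%N >-> n <= m}.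
  by apply: nondecreasing_series => m _ _.
by have := nondecreasing_cvgn_le mono cu n; rewrite {1}seriesEord.
Qed.

Lemma ell1_comb (a : R) u v : ell1 u -> ell1 v -> ell1 (fun k => a * u k + v k).
Proof.
move=> cu cv.
apply: (@ell1_bounded _ (`|a| * ell1_norm u + ell1_norm v)) => n.
apply: (@le_trans _ _ (\sum_(k < n) (`|a| * `|u k| + `|v k|))).
  by apply: ler_sum => k _; rewrite -normrM ler_normD.
rewrite big_split /= -mulr_sumr lerD ?ell1_partial_sum//.
by rewrite ler_wpM2l// ell1_partial_sum.
Qed.

Lemma ell1_diff u v : ell1 u -> ell1 v -> ell1 (fun k => u k - v k).
Proof.
move=> cu cv; rewrite (_ : (fun k => _) = (fun k => - 1 * v k + u k)); first exact: ell1_comb.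
by apply/funext => k; ring.
Qed.

Variables (x : nat -> E) (c C : R).
Hypothesis c0 : 0 < c.
Hypothesis xC : forall n, `|x n| <= C.
Hypothesis lower : forall n (a : nat -> R),
  c * \sum_(k < n) `|a k| <= `|\sum_(k < n) a k *: x k|.

Let C0 : 0 <= C. Proof. exact: le_trans (xC 0%N). Qed.

Let psum u n : E := \sum_(k < n) u k *: x k.

Let psum_le u n : `|psum u n| <= C * \sum_(k < n) `|u k|.
Proof.
apply: le_trans (ler_norm_sum _ _ _) _; rewrite mulr_sumr.
by apply: ler_sum => k _; rewrite normrZ mulrC ler_wpM2r.
Qed.

Let J u : E := limn (series (fun k => u k *: x k)).

Let J_cvg u : ell1 u -> psum u @ \oo --> J u.
Proof.
move=> cu; have -> : psum u = series (fun k => u k *: x k) by rewrite seriesEord.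
apply: normed_cvg; apply: nondecreasing_is_cvgn.
  by apply: nondecreasing_series => n _ _; exact: normr_ge0.
exists (C * ell1_norm u) => _ [n _ <-].
rewrite /normed_series_of seriesEord /=.
apply: (@le_trans _ _ (C * \sum_(k < n) `|u k|)).
  by rewrite mulr_sumr; apply: ler_sum => k _; rewrite normrZ mulrC ler_wpM2r.
by rewrite ler_wpM2l// ell1_partial_sum.
Qed.

Let J_close u (eps : R) n0 : ell1 u -> 0 < eps ->
  exists2 n, (n0 <= n)%N & `|J u - psum u n| < eps.
Proof.
move=> cu eps0; have /cvgrPdist_lt/(_ _ eps0)[N _ HN] := J_cvg cu.
by exists (maxn n0 N); [exact: leq_maxl|apply: HN; exact: leq_maxr].
Qed.

Let J_upper u : ell1 u -> `|J u| <= C * ell1_norm u.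
Proof.
move=> cu; rewrite leNgt; apply/negP => lt.
have d0 : 0 < `|J u| - C * ell1_norm u by rewrite subr_gt0.
have [n _ Hn] := J_close 0 cu d0.
have := psum_le u n; have := lerB_dist (J u) (psum u n).
have : C * \sum_(k < n) `|u k| <= C * ell1_norm u.
  by rewrite ler_wpM2l// ell1_partial_sum.
lra.
Qed.

Let J_lower_partial u m : ell1 u -> c * \sum_(k < m) `|u k| <= `|J u|.
Proof.
move=> cu; rewrite leNgt; apply/negP => lt.
have d0 : 0 < c * \sum_(k < m) `|u k| - `|J u| by rewrite subr_gt0.
have [n mn Hn] := J_close m cu d0.
have := lower n u; have := lerB_dist (psum u n) (J u); rewrite distrC.
have : c * \sum_(k < m) `|u k| <= c * \sum_(k < n) `|u k|.
  rewrite ler_pM2l//; have := @nondecreasing_series R (fun k => `|u k|) xpredT 0%N.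
  by move=> /(_ (fun _ _ _ => normr_ge0 _)) /(_ _ _ mn); rewrite !big_mkord.
rewrite -/(psum u n); lra.
Qed.

Let J_lower u : ell1 u -> c * ell1_norm u <= `|J u|.
Proof.
move=> cu; rewrite -ler_pdivlMl//.
have [//|_ -> //] := @ell1_norm_le u (c^-1 * `|J u|).
by move=> n; rewrite ler_pdivlMl//; exact: J_lower_partial.
Qed.

Let J_comb (a : R) u v : ell1 u -> ell1 v ->
  J (fun k => a * u k + v k) = a *: J u + J v.
Proof.
move=> cu cv.
have E1 := J_cvg (@ell1_comb a u v cu cv).
have E2 : psum (fun k => a * u k + v k) @ \oo --> a *: J u + J v.
  rewrite (_ : psum _ = fun n => a *: psum u n + psum v n).
    by apply: cvgD; [apply: cvgZ; [exact: cvg_cst|exact: J_cvg]|exact: J_cvg].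
  apply/funext => n; rewrite /psum scaler_sumr -big_split /=.
  by apply: eq_bigr => k _; rewrite scalerDl scalerA.
exact: (cvg_unique (@norm_hausdorff _ E) E1 E2).
Qed.

Let J_diff u v : ell1 u -> ell1 v -> J (fun k => u k - v k) = J u - J v.
Proof.
move=> cu cv; rewrite (_ : (fun k => _) = (fun k => - 1 * v k + u k)).
  by rewrite J_comb// scaleN1r addrC.
by apply/funext => k; ring.
Qed.

(** The lower estimate makes approximants [u n] of [y] Cauchy in l_1. Their coordinatewise limit [l]
    lies in l_1, and the upper estimate gives [J l = y]. *)
Let J_closed : closed [set J u | u in @ell1 R].
Proof.
move=> y cly.
have [dl [e0 dlS dl_small]] : exists dl : nat -> R, [/\ forall n, 0 < dl n,
    forall n m, (n <= m)%N -> dl m <= dl n & forall eps, 0 < eps -> exists n, dl n < eps].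
  exists (fun n => n.+1%:R^-1); split=> [n|n m nm|eps eps0].
  - by rewrite invr_gt0.
  - by rewrite lef_pV2 ?posrE// ler_nat.
  - exists (Num.trunc eps^-1); rewrite -[ltRHS]invrK ltf_pV2 ?posrE ?invr_gt0//.
    exact: truncnS_gt.
have /choice[u Hu] : forall n, exists u, ell1 u /\ `|y - J u| < dl n.
  move=> n; have [_ [[u cu <-]]] := cly _ (nbhsx_ballx y _ (e0 n)).
  by rewrite -ball_normE => yu; exists u.
have Jdist n m : (n <= m)%N -> `|J (u n) - J (u m)| <= 2 * dl n.
  move=> nm; have := (Hu n).2; have := (Hu m).2.
  have := dlS _ _ nm.
  have := ler_distD y (J (u n)) (J (u m)); rewrite [`|J (u n) - y|]distrC; lra.
have udist n m K : (n <= m)%N ->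
    \sum_(k < K) `|u n k - u m k| <= c^-1 * (2 * dl n).
  move=> nm; rewrite ler_pdivlMl//; apply: le_trans (Jdist _ _ nm).
  have [[cn _] [cm _]] := (Hu n, Hu m).
  by rewrite -J_diff//; apply: J_lower_partial; exact: ell1_diff.
have [F FU Fn] := eventually_ultra.
have /choice[l Hl] : forall k, exists l, forall eps : R, 0 < eps ->
    F [set n | `|u n k - l| < eps].
  move=> k; apply: (@ultra_bounded_cvg _ _ _ _ (`|u 0%N k| + c^-1 * (2 * dl 0%N))) => //.
  apply: filterS (Fn 0%N) => n _ /=.
  have := udist 0%N n k.+1 (leq0n n).
  rewrite big_ord_recr /=; have : 0 <= \sum_(i < k) `|u 0%N i - u n i| by exact: sumr_ge0.
  have := lerB_dist (u n k) (u 0%N k); rewrite distrC; lra.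
have ldist n K : \sum_(k < K) `|u n k - l k| <= c^-1 * (2 * dl n).
  rewrite leNgt; apply/negP => lt.
  set d := \sum_(k < K) `|u n k - l k| - c^-1 * (2 * dl n).
  have d0 : 0 < d by rewrite subr_gt0.
  (* With [K.+1], the [K] coordinate errors total strictly less than [d], even for [K = 0]. *)
  have dK : 0 < d / K.+1%:R by rewrite divr_gt0.
  have FK : F [set m | forall k, (k < K)%N -> `|u m k - l k| < d / K.+1%:R].
    by apply: filter_forall_lt => k _; exact: Hl.
  have [m [/= nm Hm]] := filter_ex (filterI (Fn n) FK).
  have : \sum_(k < K) `|u n k - l k| <=
      \sum_(k < K) (`|u n k - u m k| + d / K.+1%:R).
    apply: ler_sum => k _; apply: le_trans (ler_distD (u m k) _ _) _.
    by rewrite lerD2l ltW// Hm.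
  have zd : d / K.+1%:R *+ K < d.
    by rewrite -mulr_natr mulrAC ltr_pdivrMr// ltr_pM2l// ltr_nat ltnSn.
  rewrite big_split /= sumr_const card_ord; have := udist n m K nm.
  move: zd; move: (_ *+ K) => z; rewrite /d; lra.
have cl : ell1 l.
  apply: (@ell1_bounded _ (ell1_norm (u 0%N) + c^-1 * (2 * dl 0%N))) => n.
  apply: (@le_trans _ _ (\sum_(k < n) (`|u 0%N k| + `|u 0%N k - l k|))).
    by apply: ler_sum => k _; have := lerB_dist (l k) (u 0%N k); rewrite distrC; lra.
  by rewrite big_split /= lerD//; [apply: ell1_partial_sum; case: (Hu 0%N)|exact: ldist].
exists l => //; apply/esym/eqP; rewrite -subr_eq0 -normr_eq0 eq_le normr_ge0 andbT.
set B := 1 + C * (c^-1 * 2).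
have B0 : 0 < B by rewrite ltr_pwDl// !mulr_ge0// invr_ge0 ltW.
have yl n : `|y - J l| <= B * dl n.
  have [cn yn] := Hu n.
  have [_ nl] := @ell1_norm_le (fun k => u n k - l k) _ (ldist n).
  have := J_upper (@ell1_diff _ _ cn cl); rewrite J_diff//.
  have : C * ell1_norm (fun k => u n k - l k) <= C * (c^-1 * (2 * dl n)).
    by rewrite ler_wpM2l.
  have := ler_distD (J (u n)) y (J l); rewrite /B; lra.
rewrite leNgt; apply/negP => lt.
have [n] := dl_small _ (divr_gt0 lt B0).
by rewrite ltr_pdivlMr// mulrC => /(le_lt_trans (yl n)); rewrite ltxx.
Qed.

Lemma ell1_embedding : contains_closed_copy_of_ell1 E.
Proof.
exists [set J u | u in @ell1 R], J; split.
- exact: J_closed.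
- have z0 : ell1 (fun=> 0 : R).
    by apply: (@ell1_bounded _ 0) => n; rewrite big1// => k _; rewrite normr0.
  split.
    exists (fun=> 0) => //; rewrite -(subrr (J (fun=> 0))) -J_diff//.
    by congr J; apply/funext => k; rewrite subr0.
  move=> a _ _ [u cu <-] [v cv <-]; exists (fun k => a * u k + v k).
    exact: ell1_comb.
  exact: J_comb.
- split.
  + by move=> u cu; exists u.
  + move=> u v /set_mem cu /set_mem cv uv; apply/funext => k; apply/eqP.
    rewrite -subr_eq0 -normr_eq0 eq_le normr_ge0 andbT.
    have := J_lower_partial k.+1 (@ell1_diff _ _ cu cv).
    rewrite J_diff// uv subrr normr0 pmulr_rle0// big_ord_recr /=.
    have : 0 <= \sum_(i < k) `|u i - v i| by exact: sumr_ge0.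
    lra.
  + by move=> y [u cu <-]; exists u.
- by move=> a u v cu cv; exact: J_comb.
- exists c, (C + 1); split=> //; first by rewrite ltr_wpDl.
  move=> u cu; split; first exact: J_lower.
  apply: le_trans (J_upper cu) _; rewrite ler_wpM2r//; last by rewrite lerDl.
  by have := ell1_partial_sum 0 cu; rewrite big_ord0.
Qed.

End ell1_embedding.

(** * From a non-scattered piece to a copy of l_1 *)

Section ell1_in_E.
Context (R : realType) (E : completeNormedModType R) (X : topologicalType).
Variables (T : (X -> R) -> E) (S : E -> X -> R) (C : R).
Hypothesis TS : pointwise_weak_homeo T S.
Hypothesis T0 : T (fun=> 0) = 0.
Hypothesis TC : forall f, continuous f -> (forall x, `|f x| <= 2) -> `|T f| <= C.
Hypothesis tX : tychonoff_space R X.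

Lemma piece_not_scattered_ell1 N : ~ scattered (piece S N) ->
  contains_closed_copy_of_ell1 E.
Proof.
move=> nsc.
have [f [t [fc _ tN ft]]] :=
  compact_not_scattered_cantor tX (piece_compact TS T0 tX (n := N)) nsc.
have /choice[phi Hphi] : forall r, exists phi : nat -> E -> R,
    (forall i, (i < N)%N -> bounded_functional N%:R (phi i)) /\
    forall e, (forall i, (i < N)%N -> `|phi i e| < 1) -> `|S e (t r)| <= 1.
  by move=> r; exact: tN.
have /choice[Y HY] : forall r, exists Y : seq X, forall g, continuous g ->
    (forall y, y \in Y -> g y = 0) -> forall i, (i < N)%N -> `|phi r i (T g)| < 1 / 2.
  move=> r; have [|Y [eta [eta0 H]]] := pwh_cont_finite TS T0 (Hphi r).1 (eps := 1 / 2).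
    by lra.
  by exists Y => g gc gY; apply: H => // y yY; rewrite gY// normr0.
have [g [gc g02 ind]] := independent_functions Y fc ft.
pose e n := T (g n).
have eC n : `|e n| <= C.
  by apply: TC => // x; have /andP[? ?] := g02 n x; rewrite ger0_norm.
pose bdd (w : nat -> E -> R) := forall i, (i < N)%N -> bounded_functional N%:R (w i).
(* Two colours per functional record the sign with which it reaches 1 on [e n]. *)
pose A c n : set (nat -> E -> R) := [set w | bdd w /\
  if (c < N)%N then 1 <= w c (e n) else 1 <= - w (c - N)%N (e n)].
pose B n : set (nat -> E -> R) := [set w | bdd w /\
  forall i, (i < N)%N -> `|w i (e n)| <= 1 / 2].
have [|c cN [M HM]] := @rosenthal_dichotomy _ (N + N)%N A B.
  (* Indices [r n] realise the initial segments of [s]; the limit along [F] of their functionals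
     realises all of [s]. *)
  move=> s; have [F FU Fn] := eventually_ultra.
  have /choice[r Hr] : forall n, exists r, forall i, (i < n)%N ->
      if s i then g i (t r) = 2 else forall y, y \in Y r -> g i y = 0 by move=> n; exact: ind.
  have /choice[w Hw] : forall i, exists w : E -> R, (i < N)%N ->
      bounded_functional N%:R w /\
      forall x (eps : R), 0 < eps -> F [set n | `|phi (r n) i x - w x| < eps].
    move=> i; have [lt|ge] := ltnP i N; last by exists (fun=> 0).
    have Fi : F [set n | bounded_functional N%:R (phi (r n) i)].
      by apply: filterS (Fn 0%N) => n _; exact: (Hphi (r n)).1.
    by have [w ? ?] := ultra_functional_limit FU Fi; exists w.
  have bw : bdd w by move=> i lt; exact: (Hw i lt).1.
  exists w => n; case sn : (s n).
    apply: contrapT => nc.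
    have wlt i : (i < N)%N -> `|w i (e n)| < 1.
      move=> lt; rewrite ltNge; apply/negP; rewrite ler_normr => /orP[h|h]; apply: nc.
        by exists i; [exact: leq_trans lt (leq_addr _ _)|split; rewrite ?lt].
      exists (N + i)%N; first by rewrite ltn_add2l.
      by split; rewrite // ltnNge leq_addr /= addnC addnK.
    have Fall : F [set m | forall i, (i < N)%N -> `|phi (r m) i (e n)| < 1].
      apply: filter_forall_lt => i lt.
      have d0 : 0 < 1 - `|w i (e n)| by rewrite subr_gt0; exact: wlt.
      apply: filterS ((Hw i lt).2 (e n) _ d0) => m /=.
      by have := lerB_dist (phi (r m) i (e n)) (w i (e n)); lra.
    have [m [/= nm Hm]] := filter_ex (filterI (Fn n.+1) Fall).
    have := (Hphi (r m)).2 (e n) Hm; rewrite /e (pwhK TS (@gc n)).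
    by have := Hr m n nm; rewrite sn => ->; rewrite ger0_norm; lra.
  split=> // i lt; rewrite leNgt; apply/negP => wlt.
  have d0 : 0 < `|w i (e n)| - 1 / 2 by rewrite subr_gt0.
  have [m [/= nm Hm]] := filter_ex (filterI (Fn n.+1) ((Hw i lt).2 (e n) _ d0)).
  have := Hr m n nm; rewrite sn => gY.
  have := HY (r m) (g n) (@gc n) gY i lt; rewrite -/(e n).
  by have := lerB_dist (w i (e n)) (phi (r m) i (e n)); rewrite distrC; lra.
have N0 : (0 < N)%N by case: (N) cN.
have sep n (s : nat -> bool) : (0 < n)%N -> exists psi : E -> R,
    bounded_functional N%:R psi /\ forall i, (i < n)%N ->
    if s i then 1 <= psi (e (M i)) else psi (e (M i)) <= 1 / 2.
  move=> n0; have [w Hw] := HM n s.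
  have bw : bdd w by have := Hw 0%N n0; case: (s 0%N) => -[].
  have [lt|ge] := ltnP c N.
    exists (w c); split=> [|i lti]; first exact: bw.
    have := Hw i lti; case: (s i) => -[_]; first by rewrite lt.
    by move=> /(_ c lt); apply: le_trans; exact: ler_norm.
  have lt : (c - N < N)%N by rewrite ltn_subLR.
  exists (fun x => - w (c - N)%N x); split=> [|i lti].
    have [H1 H2] := bw _ lt; split=> [a x y|x]; first by rewrite H1; ring.
    by rewrite normrN.
  have := Hw i lti; case: (s i) => -[_]; first by rewrite ltnNge ge.
  by move=> /(_ _ lt); apply: le_trans; rewrite -normrN; exact: ler_norm.
have cpos : 0 < (4 * N%:R)^-1 :> R by rewrite invr_gt0 mulr_gt0// ltr0n.
apply: (@ell1_embedding _ _ (fun n => e (M n)) (4 * N%:R)^-1 C) => // n a.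
case: n => [|n]; first by rewrite big_ord0 mulr0.
(* [p] and [q] realise opposite sign patterns, so each term of [p z - q z] is at least [|a k| / 2].
   Both are bounded by [N], whence the constant [(4 * N%:R)^-1]. *)
have [p [bp Hp]] := sep n.+1 (fun i => 0 <= a i) isT.
have [q [bq Hq]] := sep n.+1 (fun i => ~~ (0 <= a i)) isT.
set z := \sum_(k < _) _ *: _.
have zp : p z = \sum_(k < n.+1) a k * p (e (M k)).
  rewrite /z (@bounded_functional_sum _ _ _ p (fun k => a k *: e (M k)) _ bp).
  by apply: eq_bigr => k _; rewrite (bounded_functionalZ _ _ bp).
have zq : q z = \sum_(k < n.+1) a k * q (e (M k)).
  rewrite /z (@bounded_functional_sum _ _ _ q (fun k => a k *: e (M k)) _ bq).
  by apply: eq_bigr => k _; rewrite (bounded_functionalZ _ _ bq).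
have main : \sum_(k < n.+1) `|a k| <= 2 * (p z - q z).
  rewrite zp zq -sumrB mulr_sumr; apply: ler_sum => k _.
  have := Hp k (ltn_ord k); have := Hq k (ltn_ord k).
  case: (leP 0 (a k)) => ak /= h1 h2.
    have : 0 <= a k * (p (e (M k)) - q (e (M k)) - 1 / 2) by rewrite mulr_ge0//; lra.
    rewrite ger0_norm//; lra.
  have : 0 <= - a k * (q (e (M k)) - p (e (M k)) - 1 / 2) by rewrite mulr_ge0//; lra.
  rewrite ltr0_norm//; lra.
rewrite ler_pdivrMl; last by rewrite mulr_gt0// ltr0n.
have := bp.2 z; have := bq.2 z; have := ler_norm (p z); have := ler_norm (- q z).
rewrite normrN; lra.
Qed.

End ell1_in_E.

Theorem theorem1p7 (R : realType) (E : completeNormedModType R)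
    (X : topologicalType) :
  tychonoff_space R X ->
  ~ finite_set [set: X] ->
  (exists T : {ptws X -> R} -> weak_topology E, Cp_weak_homeomorphism T) ->
  (exists Xn : nat -> set X,
      [/\ \bigcup_n Xn n = [set: X],
          (forall n, compact (Xn n)) &
          exists n, ~ scattered (Xn n)]) /\
  contains_closed_copy_of_ell1 E.
Proof.
move=> tX infX [T /Cp_weak_homeomorphism_pointwise[S TS]].
have [g0 [r [C [g0c r0 HC]]]] := pointwise_weak_homeo_locally_bounded TS.
(* Scaling by [r / 2] carries the ball of radius 2 into the ball of radius [r] about [g0], on which
   [T] is bounded. *)
have r20 : 0 < r / 2 by rewrite divr_gt0.
have TS' := pointwise_weak_homeo_recenter TS g0c r20.
set T' := (fun f => _) in TS'; set S' := (fun e => _) in TS'.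
have T0 : T' (fun=> 0) = 0.
  rewrite /T' (_ : (fun x => _) = g0) ?subrr//.
  by apply/funext => x; rewrite mulr0 addr0.
have TC f : continuous f -> (forall x, `|f x| <= 2) -> `|T' f| <= C + `|T g0|.
  move=> fc f2; apply: le_trans (ler_normB _ _) _; rewrite lerD2r; apply: HC.
    move=> x; apply: cvgD; first exact: g0c.
    by apply: cvgM; [exact: cvg_cst|exact: fc].
  move=> x; rewrite addrAC subrr add0r normrM gtr0_norm//.
  by rewrite mulrAC ler_pdivrMr// ler_pM2l.
have [N nN] := piece_not_scattered TS' T0 tX infX.
split; last exact: piece_not_scattered_ell1 TS' T0 TC tX _ nN.
exists (piece S'); split; first exact: piece_cover TS' T0.
  by move=> n; exact: piece_compact TS' T0 tX _.
by exists N.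
Qed.
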